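(* Let $p$ be a prime, let $g\in\mathbb{F}_p^*$ have multiplicative order $t$, and let $N$ be a positive integer with $N\le t$. Let $S_{g,p}(\lambda,N)=\sum_{n=1}^{N}e^{2\pi i\lambda g^n/p}$. Then $$\max_{\gcd(\lambda,p)=1}|S_{g,p}(\lambda,N)|\ll\begin{cases}p^{1/8}t^{22/36}(\log p)^{7/6}, & t\le p^{1/2},\\ p^{1/4}t^{13/36}(\log p)^{7/6}, & p^{1/2}<t\le p^{3/5}(\log p)^{-6/5},\\ p^{1/6}t^{1/2}(\log p)^{4/3}, & p^{3/5}(\log p)^{-6/5}<t\le p^{2/3}(\log p)^{-2/3},\\ p^{1/2}\log p, & t>p^{2/3}(\log p)^{-2/3}.\end{cases}$$
   Context: $\mathbb{F}_p$ is the field of $p$ elements, identified with residues modulo $p$, so $e^{2\pi i z/p}$ is well defined for $z\in\mathbb{F}_p$. The maximum is over integers $\lambda$ coprime to $p$. The notation $f\ll h$ means $f\le Ch$ for some absolute constant $C$ (independent of $p,g,t,N$). *)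

(* Defs.v *)
From HB Require Import structures.
From mathcomp Require Import all_boot all_order all_algebra all_fingroup.
From mathcomp Require Import all_classical all_reals all_analysis.
From mathcomp Require Import complex.

Set Implicit Arguments.
Unset Strict Implicit.
Unset Printing Implicit Defensive.

Import Order.TTheory GRing.Theory Num.Theory.

Local Open Scope ring_scope.
Local Open Scope complex_scope.

(* [exp (i x)], spelled out by Euler's formula. *)
Definition cis (R : realType) (x : R) : R[i] := cos x +i* sin x.

(* [exp (2 pi i z / p)]; the coercion ['F_p >-> nat] gives the residue of [z]
   in [0, p) (['F_p] is the field with [p] elements only when [p] is prime). *)
Definition additive_char (R : realType) (p : nat) (z : 'F_p) : R[i] :=
  cis (2 * pi * (z : nat)%:R / p%:R : R).

Definition exp_sum (R : realType) (p : nat) (g : {unit 'F_p}) (lambda : int)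
    (N : nat) : R[i] :=
  \sum_(1 <= n < N.+1) additive_char R (lambda%:~R * val g ^+ n).

(* Main.v *)
Require Import Defs.
From HB Require Import structures.
From mathcomp Require Import all_boot all_order all_algebra all_fingroup.
From mathcomp Require Import zify ring lra.

Set Implicit Arguments.
Unset Strict Implicit.
Unset Printing Implicit Defensive.

Import Order.TTheory GRing.Theory Num.Theory.
Local Open Scope ring_scope.

(* Let [G] be the group of [t]-th roots of unity in [F_p].  Stepanov's method
   bounds, for any set of pairs of cosets of [G], the number of [w] such that
   [w] and [1 - w] lie in one of these pairs.  Summed dyadically, this gives the
   energy bounds
     E_3(G) = #{x_1 - y_1 = x_2 - y_2 = x_3 - y_3} << t^3 log t  (t^3 <= p^2),
     T_3(G) = #{x_1 + x_2 + x_3 = y_1 + y_2 + y_3} << t^4 log t  (t^2 <= p).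
   For [T_3], Cauchy-Schwarz over the value of the product reduces to solutions
   with also [x_1 x_2 x_3 = y_1 y_2 y_3], and these are parametrized by the
   solutions in [G] of [(c_1 - 1)(b_2 - 1) = (c_2 - 1)(b_1 - 1)].

   For [I, J] included in [G], the sum of [e(lambda x y / p)] over [I * J] is at
   most [mu |I|^(1/2) |J|^(1/2)] with either of
     mu^2 = p,   mu^6 = p E_3(G),   mu^18 = t^6 p T_3(G)^2;
   the second bound comes from the trace of [(B B^* )^3] for the matrix [B] of
   the bilinear form, the third from Hoelder's inequality.  An incomplete sum
   over powers of [g] is [<< mu log t]: averaging its partial sums over windows
   of length 1, 2, 4, ... changes them by such bilinear sums only.  The second
   value of [mu] gives the stated bounds for [p^(3/8) <= t <= p^(2/3)], the third
   one for smaller [t], and the first one for larger [t]. *)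

(** * Sparse polynomials in characteristic [p] *)

Section SparsePolynomials.
Variables (F : fieldType) (p : nat).
Hypothesis charF : p \in [pchar F].

Lemma natf_inj_small (i j : nat) : (i < p)%N -> (j < p)%N ->
  i%:R = j%:R :> F -> i = j.
Proof.
wlog le_ij : i j / (i <= j)%N => [hw|] lt_ip lt_jp eq_ij.
  by case/orP: (leq_total i j) => le_ij; [|symmetry]; apply: hw.
have : (j - i)%:R == 0 :> F by rewrite natrB // eq_ij subrr.
rewrite -(dvdn_pcharf charF) => /dvdnP[k]; case: k => [|k]; first by lia.
rewrite mulSn; lia.
Qed.

(* The operator [X d/dX - e] removes the monomial of degree [e] and lowers the
   multiplicity of the root [1] by at most one. *)
Lemma sparse_poly_eq0 (k : nat) (f : {poly F}) : (size f <= p)%N ->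
  (#|[set i : 'I_p | (f`_i != 0)%R]| <= k)%N -> ('X - 1) ^+ k %| f -> f = 0.
Proof.
elim: k f => [|k IH] f szf; first rewrite leqn0 cards_eq0 => /eqP supp0 _.
  apply/polyP=> i; rewrite coef0.
  have [lt_i|le_i] := ltnP i p; last by rewrite nth_default // (leq_trans szf).
  have /setP/(_ (Ordinal lt_i)) := supp0.
  by rewrite !inE /= => /negbT; rewrite negbK => /eqP.
move=> suppf dvf.
have [->//|nzf] := eqVneq f 0.
have sz0 : (0 < size f)%N by rewrite size_poly_gt0.
set e := (size f).-1.
have lt_ep : (e < p)%N by rewrite /e; lia.
have lc : f`_e != 0 by rewrite -lead_coefE lead_coef_eq0.
pose h := 'X * f^`() - e%:R *: f.
have hE i : h`_i = (i%:R - e%:R) * f`_i.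
  rewrite /h coefB coefZ coefXM coef_deriv; case: i => [|i] /=.
    by rewrite !sub0r mulNr.
  by rewrite mulrBl -[_ *+ i.+1]mulr_natl.
have h0 : h = 0.
  apply: IH.
  - apply/leq_sizeP => j lej; rewrite hE nth_default ?mulr0 //.
    exact: leq_trans lej.
  - rewrite -ltnS; apply: leq_trans suppf.
    apply: proper_card; apply/properP; split.
      apply/subsetP => i; rewrite !inE hE; apply: contra => /eqP ->.
      by rewrite mulr0.
    by exists (Ordinal lt_ep); rewrite !inE ?hE /= ?subrr ?mul0r ?eqxx.
  - case/dvdpP: dvf => q fq; rewrite /h fq derivM deriv_exp /=.
    rewrite derivB derivX -polyC1 derivC subr0 mul1r polyC1 exprS.
    apply: dvdp_sub.
      apply/dvdp_mull/dvdp_add; first by do 2!apply: dvdp_mull.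
      by rewrite -mulr_natl; do 2!apply: dvdp_mull.
    by rewrite -mul_polyC; do 3!apply: dvdp_mull.
(* [h = 0] leaves only the leading monomial of [f], which does not vanish at [1]. *)
have fE : f = f`_e *: 'X^e.
  apply/polyP => i; rewrite coefZ coefXn.
  have [->|ne_ie] := eqVneq i e; first by rewrite mulr1.
  rewrite mulr0; have [lt_i|le_i] := ltnP i p; last first.
    by rewrite nth_default // (leq_trans szf).
  have /eqP := hE i; rewrite h0 coef0 eq_sym mulf_eq0 subr_eq0.
  by case/orP => /eqP // /(natf_inj_small lt_i lt_ep) /eqP; rewrite (negPf ne_ie).
case/dvdpP: dvf => q /(congr1 (fun g => g.[1])).
rewrite fE !hornerE subrr expr0n !mulr0 ?expr1n ?mulr1 => /eqP.
by rewrite (negPf lc).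
Qed.
End SparsePolynomials.

(** * Multiplicities of roots and expansions in powers of a polynomial *)

Section PolynomialLemmas.
Variable F : fieldType.

Lemma mulX_derivXn (n : nat) : 'X * ('X^n)^`() = n%:R *: 'X^n :> {poly F}.
Proof. by case: n => [|n]; rewrite derivXn ?mulr0 ?scale0r //= mulrnAr -exprS scaler_nat. Qed.

Lemma mul_deriv_1subXn (n : nat) :
  (1 - 'X) * ((1 - 'X) ^+ n)^`() = - (n%:R *: (1 - 'X) ^+ n) :> {poly F}.
Proof.
case: n => [|n]; first by rewrite expr0 -polyC1 derivC mulr0 scale0r oppr0.
rewrite deriv_exp derivB derivX -polyC1 derivC sub0r polyC1 mulN1r /=.
by rewrite mulNrn mulrN mulrnAr -exprS scaler_nat.
Qed.

Lemma prod_XsubC_exp_dvdp (D : nat) (f : {poly F}) (s : seq F) : uniq s ->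
  (forall w, w \in s -> ('X - w%:P) ^+ D %| f) ->
  (\prod_(w <- s) ('X - w%:P)) ^+ D %| f.
Proof.
elim: s => [|w s IH] /=; first by rewrite big_nil expr1n dvd1p.
case/andP=> w_notin us dvf; rewrite big_cons exprMn Gauss_dvdp.
  rewrite dvf ?mem_head //= IH // => x xs.
  by apply: dvf; rewrite in_cons xs orbT.
apply/coprimep_expl/coprimep_expr; rewrite coprimep_sym.
by rewrite coprimep_XsubC root_prod_XsubC.
Qed.

Lemma multiplicity_size (D : nat) (f : {poly F}) (s : seq F) : uniq s ->
  f != 0 -> (forall w, w \in s -> ('X - w%:P) ^+ D %| f) ->
  (D * size s < size f)%N.
Proof.
move=> us nzf /(prod_XsubC_exp_dvdp us) /(dvdp_leq nzf); apply: leq_trans.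
have := size_exp (\prod_(w <- s) ('X - w%:P)) D.
rewrite size_prod_XsubC /= mulnC.
have : (0 < size ((\prod_(w <- s) ('X - w%:P)) ^+ D))%N.
  by rewrite size_poly_gt0 expf_neq0 // monic_neq0 // monic_prod_XsubC.
by case: size => // n _ /= ->.
Qed.

(** All terms but the lowest are divisible by [y], so [s 0] is too and vanishes; one factor [y] then
    cancels, and induction applies. *)
Lemma power_expansion_eq0 (y : {poly F}) (B : nat) (s : nat -> {poly F}) :
  y != 0 -> (forall c, (c < B)%N -> y %| s c -> s c = 0) ->
  \sum_(c < B) s c * y ^+ c = 0 -> forall c, (c < B)%N -> s c = 0.
Proof.
move=> nzy; elim: B s => [|B IH] s small sum0 // c.
move: sum0; rewrite big_ord_recl /= expr0 mulr1.
set r := \sum_(_ < _) _ => sum0.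
have rE : r = y * \sum_(c < B) s c.+1 * y ^+ c.
  by rewrite mulr_sumr; apply: eq_bigr => i _; rewrite /bump /= exprS mulrCA.
have s0 : s 0%N = 0.
  apply: small => //; move/eqP: sum0; rewrite addr_eq0 => /eqP ->.
  by rewrite dvdpNr rE dvdp_mulr.
move: sum0; rewrite s0 add0r rE => /eqP; rewrite mulf_eq0 (negPf nzy) => /eqP.
move=> /(IH (s \o succn)) /= IHs; case: c => [|c] // ltc; apply: IHs => //.
by move=> i lti; apply: small.
Qed.
End PolynomialLemmas.

(* Its values are the pairs of cosets, modulo the [t]-th roots of unity, in which
   [w] and [1 - w] lie. *)
Definition power_pair (F : nzRingType) (t : nat) (w : F) : F * F :=
  (w ^+ t, (1 - w) ^+ t).

(** [0] and [1] are left out because the operator [theta] below degenerates there. *)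
Definition fibres (F : finFieldType) (t : nat) (P : {set F * F}) : {set F} :=
  [set w | [&& w != 0, w != 1 & power_pair t w \in P]].

(** * Stepanov's auxiliary polynomial *)

Section Stepanov.
Variables (F : finFieldType) (p t : nat).
Hypothesis charF : p \in [pchar F].

(** The factor ['X * (1 - 'X)] makes [theta] preserve products [q X^(tb) (1 - X)^(tc)], changing
    only [q]. *)
Let theta (f : {poly F}) := 'X * (1 - 'X) * f^`().

(** If [f = r (X - w)^D] with [0 < D < p], then [(X - w)^D] divides [theta f] only if
    [D w (1 - w) r(w) = 0], that is, [r(w) = 0]. So the multiplicity grows by one at each induction
    step. *)
Let theta_dvdp (w : F) (D : nat) (f : {poly F}) : w != 0 -> w != 1 ->
  (D <= p)%N -> (forall j, (j < D)%N -> (iter j theta f).[w] = 0) ->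
  ('X - w%:P) ^+ D %| f.
Proof.
move=> w0 w1; elim: D f => [|D IH] f leD fw; first by rewrite expr0 dvd1p.
have [||r fE] := dvdpP _ _ (IH f _ _); [lia|by move=> j lt; apply: fw; lia|].
have /IH : forall j, (j < D)%N -> (iter j theta (theta f)).[w] = 0.
  by move=> j lt; rewrite -iterSr; apply: fw.
move=> /(_ (ltnW leD)); rewrite fE exprS dvdp_mul2r ?expf_neq0 ?polyXsubC_eq0 //.
case: D IH leD fw fE => [|D] IH leD fw fE dv.
  by have := fw 0%N isT; rewrite fE expr0 mulr1 dvdp_XsubCl /root /= => ->.
move: dv; rewrite /theta derivM deriv_exp derivXsubC mul1r /= exprS.
set y := 'X - w%:P.
rewrite (_ : 'X * (1 - 'X) * _ = (y * ('X * (1 - 'X) * r^`()) +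
   D.+1%:R%:P * ('X * (1 - 'X) * r)) * y ^+ D); last first.
  by rewrite -[_ ^+ D *+ _]mulr_natl polyC_natr; ring.
rewrite dvdp_mul2r ?expf_neq0 ?polyXsubC_eq0 //.
rewrite dvdp_addr; last exact: dvdp_mulr.
rewrite !dvdp_XsubCl /root !hornerE !mulf_eq0.
rewrite -(dvdn_pcharf charF) (negPf w0) subr_eq0 eq_sym (negPf w1) /=.
by rewrite gtnNdvd.
Qed.

Let term (b c : nat) (q : {poly F}) := q * ('X^(t * b) * (1 - 'X) ^+ (t * c)).

Let twist (b c : nat) (q : {poly F}) :=
  'X * (1 - 'X) * q^`() + (t * b)%:R *: ((1 - 'X) * q) - (t * c)%:R *: ('X * q).

Let theta_term b c q : theta (term b c q) = term b c (twist b c q).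
Proof.
have eX := mulX_derivXn F (t * b); have eY := mul_deriv_1subXn F (t * c).
rewrite /theta /term /twist !derivM.
transitivity ('X * (1 - 'X) * q^`() * ('X^(t * b) * (1 - 'X) ^+ (t * c)) +
  q * ((1 - 'X) * (1 - 'X) ^+ (t * c) * ('X * 'X^(t * b)^`()) +
       'X * 'X^(t * b) * ((1 - 'X) * ((1 - 'X) ^+ (t * c))^`()))); first by ring.
by rewrite eX eY -!mul_polyC; ring.
Qed.

Let iter_theta_term j b c q :
  iter j theta (term b c q) = term b c (iter j (twist b c) q).
Proof. by elim: j => //= j ->; rewrite theta_term. Qed.

Let thetaD f1 f2 : theta (f1 + f2) = theta f1 + theta f2.
Proof. by rewrite /theta derivD mulrDr. Qed.

Let iter_theta_sum (I : finType) j (f : I -> {poly F}) :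
  iter j theta (\sum_i f i) = \sum_i iter j theta (f i).
Proof.
have theta0 : theta 0 = 0 by rewrite /theta -polyC0 derivC mulr0.
elim: j => //= j ->; exact: (big_morph theta thetaD theta0).
Qed.

Let twistB b c q1 q2 : twist b c (q1 - q2) = twist b c q1 - twist b c q2.
Proof. by rewrite /twist derivB -!mul_polyC; ring. Qed.

Let iter_twistB j b c q1 q2 :
  iter j (twist b c) (q1 - q2) = iter j (twist b c) q1 - iter j (twist b c) q2.
Proof. by elim: j => //= j ->; rewrite twistB. Qed.

Let size_twist b c (q : {poly F}) n : (size q <= n)%N -> (size (twist b c q) <= n.+1)%N.
Proof.
move=> szq.
have sz1X : (size (1 - 'X : {poly F})%R <= 2)%N.
  by rewrite -opprB size_polyN -polyC1 size_XsubC.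
have szX : (size ('X : {poly F})%R <= 2)%N by rewrite size_polyX.
have szM (u v : {poly F}) m : (size u <= 2)%N -> (size v <= m)%N -> (size (u * v)%R <= m.+1)%N.
  by move=> szu szv; apply: leq_trans (size_polyMleq _ _) _; lia.
have [->|nzq] := eqVneq q 0.
  by rewrite /twist -polyC0 derivC polyC0 !mulr0 !scaler0 subr0 addr0 size_poly0.
rewrite /twist (leq_trans (size_polyD _ _)) // geq_max size_polyN.
rewrite (leq_trans (size_polyD _ _)) ?geq_max; last first.
  apply/andP; split; last by apply: leq_trans (size_scale_leq _ _) _; exact: szM.
  have := lt_size_deriv nzq; rewrite -mulrA => ltd.
  case: n szq => [|n] szq; first by lia.
  by apply: (szM _ _ _ szX); apply: szM => //; lia.
by apply: leq_trans (size_scale_leq _ _) _; exact: szM.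
Qed.

Let size_iter_twist j b c (q : {poly F}) n : (size q <= n)%N ->
  (size (iter j (twist b c) q) <= n + j)%N.
Proof.
move=> szq; elim: j => [|j IH] /=; first by rewrite addn0.
by rewrite addnS; exact: size_twist.
Qed.

Section Coefficients.
Variables A B : nat.
(** The [A B^2] unknowns of a linear system: [q (b, c, a)] is the coefficient of [X^a] in the factor
    of [X^(tb) (1 - X)^(tc)]. *)
Let coefs := {ffun 'I_B * 'I_B * 'I_A -> F}.

Let cpoly (q : coefs) (b c : 'I_B) : {poly F} :=
  \sum_(a < A) q (b, c, a) *: 'X^a.

Let size_cpoly q b c : (size (cpoly q b c) <= A)%N.
Proof.
apply: leq_trans (size_sum _ _ _) _; apply/bigmax_leqP => a _.
by apply: leq_trans (size_scale_leq _ _) _; rewrite size_polyXn.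
Qed.

Let aux (q : coefs) : {poly F} :=
  \sum_(b < B) \sum_(c < B) term b c (cpoly q b c).

Let size_aux q : (0 < A)%N -> (0 < B)%N -> (size (aux q) <= A + 2 * t * B)%N.
Proof.
move=> A0 B0; apply: leq_trans (size_sum _ _ _) _; apply/bigmax_leqP => b _.
apply: leq_trans (size_sum _ _ _) _; apply/bigmax_leqP => c _.
have szY : (size ((1 - 'X) ^+ (t * c) : {poly F})%R <= (t * c).+1)%N.
  apply: leq_trans (size_poly_exp_leq _ _) _.
  by rewrite -opprB size_polyN -polyC1 size_XsubC mul1n.
have szXY : (size ('X^(t * b) * (1 - 'X) ^+ (t * c) : {poly F})%R <= t * b + (t * c).+1)%N.
  by apply: leq_trans (size_polyMleq _ _) _; rewrite size_polyXn addSn /= leq_add2l.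
have leb : (t * b <= t * B)%N by rewrite leq_mul2l ltnW ?orbT.
have lec : (t * c <= t * B)%N by rewrite leq_mul2l ltnW ?orbT.
apply: leq_trans (size_polyMleq _ _) _; rewrite -subn1 leq_subLR.
apply: leq_trans (leq_add (size_cpoly q b c) szXY) _; lia.
Qed.

(** Expand [aux q] in powers of [(1 - X)^t]. Each coefficient [s c] has degree below [p] and at most
    [A B <= t] monomials, so by [sparse_poly_eq0] it is divisible by [(1 - X)^t] only if it is zero.
    As [A <= t], the exponents [t b + a] are distinct, so [q] can be read off from the [s c]. *)
Let aux_neq0 (q : coefs) : (A * B <= t)%N -> (A + t * B <= p)%N ->
  aux q = 0 -> q = 0.
Proof.
move=> leABt leABp aux0.
pose s (c : nat) : {poly F} :=
  if insub c is Some c' then \sum_(b < B) cpoly q b c' * 'X^(t * b) else 0.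
have sE (c : 'I_B) : s c = \sum_(b < B) \sum_(a < A) q (b, c, a) *: 'X^(t * b + a).
  rewrite /s valK; apply: eq_bigr => b _; rewrite mulr_suml.
  by apply: eq_bigr => a _; rewrite -scalerAl -exprD addnC.
have coef_s (c : 'I_B) i :
    (s c)`_i = \sum_(x : 'I_B * 'I_A) q (x.1, c, x.2) * (i == t * x.1 + x.2)%N%:R.
  rewrite sE -(pair_bigA _ (fun b a => q (b, c, a) * (i == t * b + a)%N%:R)) /=.
  rewrite coef_sum; apply: eq_bigr => b _; rewrite coef_sum.
  by apply: eq_bigr => a _; rewrite coefZ coefXn.
have lt_exp (x : 'I_B * 'I_A) : (t * x.1 + x.2 < p)%N.
  case: x => b a /=; have : (t * b <= t * B)%N by rewrite leq_mul2l ltnW ?orbT.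
  by have := ltn_ord a; lia.
have s0 c : (c < B)%N -> s c = 0.
  apply: (@power_expansion_eq0 _ ((1 - 'X) ^+ t)).
  - by rewrite expf_neq0 // -opprB oppr_eq0 -polyC1 polyXsubC_eq0.
  - move=> {}c ltc dv; pose c' := Ordinal ltc; rewrite -[c]/(val c') in dv *.
    apply: (sparse_poly_eq0 charF (k := t)).
    + apply/leq_sizeP => i lei; rewrite coef_s big1 // => x _.
      by have := lt_exp x; case: eqP => [|_]; [lia|rewrite mulr0].
    + pose f x := Ordinal (lt_exp x).
      apply: (@leq_trans #|{: 'I_B * 'I_A}|); last by rewrite card_prod !card_ord mulnC.
      apply: leq_trans (leq_imset_card f predT); apply/subset_leq_card/subsetP.
      move=> i; rewrite inE coef_s; apply: contraNT => /imsetP fP.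
      rewrite big1 // => x _; case: eqP => [e|_]; last by rewrite mulr0.
      by case: fP; exists x => //; apply: val_inj.
    + apply: dvdp_trans dv; apply: dvdp_exp2r.
      by rewrite -opprB dvdpNl.
  rewrite -[RHS]aux0 /aux exchange_big; apply: eq_bigr => c0 _.
  rewrite /s valK mulr_suml; apply: eq_bigr => b _.
  by rewrite /term -exprM mulrA.
apply/ffunP => -[[b c] a]; rewrite ffunE.
have := coef_s c (t * b + a)%N; rewrite s0 // coef0 (bigD1 (b, a)) //= eqxx mulr1.
rewrite big1 ?addr0 // => -[b' a'] /= ne; case: eqP => [e|_]; last by rewrite mulr0.
have leAt : (A <= t)%N.
  by apply: leq_trans leABt; rewrite leq_pmulr // (leq_ltn_trans _ (ltn_ord b)).
have lta : (a < t)%N by apply: leq_trans leAt.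
have lta' : (a' < t)%N by apply: leq_trans leAt.
case/negP: ne; apply/eqP; congr (_, _); apply: val_inj => /=.
  have := congr1 (fun n => n %/ t)%N e.
  by rewrite ![(t * _)%N]mulnC !divnMDl ?divn_small ?addn0 //; lia.
have := congr1 (fun n => n %% t)%N e; rewrite ![(t * _)%N]mulnC !modnMDl !modn_small //.
Qed.

(** On the fibre over [k], [X^(tb)] and [(1 - X)^(tc)] take the constant values [k.1^b] and [k.2^c].
    The [j]-th iterate of [theta] on [aux q] thus agrees there with a polynomial of degree below
    [A + j]; making it vanish identically costs few linear conditions, whatever the size of the
    fibre. *)
Let keypoly (q : coefs) (j : nat) (k : F * F) : {poly F} :=
  \sum_(b < B) \sum_(c < B)
    (k.1 ^+ b * k.2 ^+ c) *: iter j (twist b c) (cpoly q b c).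

Let size_keypoly q j k : (size (keypoly q j k) <= A + j)%N.
Proof.
apply: leq_trans (size_sum _ _ _) _; apply/bigmax_leqP => b _.
apply: leq_trans (size_sum _ _ _) _; apply/bigmax_leqP => c _.
by apply: leq_trans (size_scale_leq _ _) _; exact: size_iter_twist.
Qed.

Let keypolyB q1 q2 j k :
  keypoly (q1 - q2) j k = keypoly q1 j k - keypoly q2 j k.
Proof.
rewrite /keypoly -sumrB; apply: eq_bigr => b _; rewrite -sumrB.
apply: eq_bigr => c _; rewrite -scalerBr -iter_twistB; congr (_ *: iter _ _ _).
by rewrite /cpoly -sumrB; apply: eq_bigr => a _; rewrite !ffunE scalerBl.
Qed.

Let horner_theta_aux q j w :
  (iter j theta (aux q)).[w] = (keypoly q j (power_pair t w)).[w].
Proof.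
rewrite /aux /keypoly iter_theta_sum !horner_sum; apply: eq_bigr => b _.
rewrite iter_theta_sum !horner_sum; apply: eq_bigr => c _.
rewrite iter_theta_term /term hornerZ hornerM mulrC; congr (_ * _).
by rewrite !hornerE -!exprM.
Qed.

(* Stepanov's method: the auxiliary polynomial
   [\sum_(b, c < B) q_bc X^(tb) (1 - X)^(tc)], with [deg q_bc < A], is nonzero
   and vanishes to order [D] on all the fibres over [P]. *)
Lemma stepanov (D : nat) (P : {set F * F}) :
  (A * B <= t)%N -> (A + t * B <= p)%N -> (D <= A)%N ->
  (2 * #|P| * D < B ^ 2)%N ->
  (D * #|fibres t P| <= A + 2 * t * B)%N.
Proof.
move=> leAB leABp leDA ltD; set W := fibres t P.
have [->//|D0] := posnP D.
have A0 : (0 < A)%N by lia.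
have B0 : (0 < B)%N by case: (B) ltD.
(* The coefficients below [2 A] suffice, since [A + j <= A + D <= 2 A]. There are
   [2 A D #|P| < A B^2] conditions, fewer than unknowns, so [phi] is not injective. *)
pose phi (q : coefs) : {ffun {k | k \in P} * 'I_D * 'I_(2 * A) -> F} :=
  [ffun x : {k | k \in P} * 'I_D * 'I_(2 * A) => (keypoly q x.1.2 (val x.1.1))`_(val x.2)].
have [q nzq phi0] : exists2 q : coefs, q != 0 &
    forall (j : 'I_D) k, k \in P -> keypoly q j k = 0.
  have : ~~ injectiveb phi.
    apply/negP => /injectiveP /leq_card; rewrite !card_ffun !card_prod !card_ord.
    rewrite card_sig leq_exp2l; last by exact: card_finNzRing_gt1.
    rewrite (eq_card (B := P)) //; nia.
  case/injectivePn => q1 [q2 ne12 eq12]; exists (q1 - q2).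
    by rewrite subr_eq0.
  move=> j k kP; rewrite keypolyB; apply/polyP => i; rewrite coefB coef0.
  have [lti|lei] := ltnP i (2 * A).
    have /ffunP/(_ (exist _ k kP, j, Ordinal lti)) := eq12.
    by rewrite !ffunE /= => ->; rewrite subrr.
  have le_sz : (A + j <= i)%N by have := ltn_ord j; lia.
  by rewrite !nth_default ?subrr // (leq_trans (size_keypoly _ _ _)).
have nz : aux q != 0.
  by apply: contra_neq nzq => aux0; apply: aux_neq0.
have := @multiplicity_size _ D (aux q) (enum W) (enum_uniq _) nz.
rewrite -cardE => szW; apply: leq_trans (size_aux q A0 B0); apply: ltnW.
apply: szW => w; rewrite mem_enum inE => /and3P[w0 w1 wP].
apply: theta_dvdp => //; first by lia.
by move=> j ltj; rewrite horner_theta_aux (phi0 (Ordinal ltj)) ?horner0.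
Qed.
End Coefficients.
End Stepanov.

(** * Bounds for the number of large fibres *)

Section LevelSets.
Variables (F : finFieldType) (p t : nat).
Hypotheses (charF : p \in [pchar F]) (t_gt0 : (0 < t)%N).

Lemma card_unity_roots_le (u : F) : (#|[set x : F | (x ^+ t == u)%R]| <= t)%N.
Proof.
have szf : size ('X^t - u%:P : {poly F})%R = t.+1 by rewrite size_XnsubC.
have nzf : 'X^t - u%:P != 0 :> {poly F} by rewrite -size_poly_eq0 szf.
rewrite -ltnS -szf cardE; apply: max_poly_roots => //; last exact: enum_uniq.
apply/allP => x; rewrite mem_enum inE => /eqP xt.
by rewrite /root !hornerE xt subrr.
Qed.

Lemma card_fibre_le (k : F * F) : (#|fibres t [set k]| <= t)%N.
Proof.
apply: leq_trans (card_unity_roots_le k.1); apply/subset_leq_card/subsetP => w.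
by rewrite !inE => /and3P[_ _ /eqP <-].
Qed.

Lemma card_fibres (P : {set F * F}) :
  #|fibres t P| = (\sum_(k in P) #|fibres t [set k]|)%N.
Proof.
rewrite -sum1_card (partition_big (power_pair t) (mem P)) /=; last first.
  by move=> w; rewrite inE => /and3P[].
apply: eq_bigr => k kP; rewrite -sum1_card; apply: eq_bigl => w.
rewrite !inE; have [->|_] := eqVneq (power_pair t w) k; first by rewrite kP !andbT.
by rewrite !andbF.
Qed.

(** With [h = #|P|], [stepanov] is applied with [B] about [(2 h t)^(1/3)], [A] about [t / B] and [D]
    about [B^2 / (2 h)]. It gives [h d D <= 3 t B], hence [d B <= 12 t], which is then cubed. The
    two size hypotheses ensure [4 B <= t] and [2 t B <= p]. *)
Lemma level_set_small (P : {set F * F}) (d : nat) :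
  (forall k, k \in P -> d <= #|fibres t [set k]|)%N ->
  (128 * #|P| <= t ^ 2)%N -> (16 * #|P| * t ^ 4 <= p ^ 3)%N ->
  (#|P| * d ^ 3 <= 4 * 12 ^ 3 * t ^ 2)%N.
Proof.
move=> dP; set h := #|P| => h1 h2.
have [->//|h0] := posnP h.
have [B /andP[B1 B2]] : exists B, (B ^ 3 <= 2 * h * t < B.+1 ^ 3)%N.
  have ex : exists B, (B ^ 3 <= 2 * h * t)%N by exists 0%N.
  have bd B : (B ^ 3 <= 2 * h * t -> B <= 2 * h * t)%N.
    by apply: leq_trans; rewrite -{1}(expn1 B); case: B => // B; rewrite leq_pexp2l.
  case: (ex_maxnP ex bd) => B B1 B2; exists B; rewrite B1 ltnNge.
  by apply/negP => /B2; rewrite ltnn.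
have t4 : (4 <= t)%N.
  rewrite leqNgt; apply/negP => lt4; have : (t ^ 2 <= 3 ^ 2)%N by rewrite leq_exp2r.
  lia.
have ht4 : (4 <= h * t)%N by rewrite -[4%N]mul1n leq_mul.
have B_ge2 : (2 <= B)%N.
  rewrite -ltnS -(ltn_exp2r _ _ (e := 3)) //; apply: leq_ltn_trans B2.
  by rewrite -mulnA; lia.
(* As [B >= 2], [B + 1 <= 3 B / 2]; so [2 h t < (3 B / 2)^3]. *)
have BL : (16 * (h * t) < 27 * B ^ 3)%N.
  have : ((2 * B.+1) ^ 3 <= (3 * B) ^ 3)%N by rewrite leq_exp2r; lia.
  by rewrite !expnMn -mulnA in B2 *; lia.
have Bt : (4 * B <= t)%N.
  rewrite -(leq_exp2r _ _ (e := 3)) // expnMn.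
  have : (128 * h * t <= t ^ 2 * t)%N by rewrite leq_mul2r h1 orbT.
  by rewrite -expnSr -!mulnA in B1 *; lia.
have tB : (2 * (t * B) <= p)%N.
  rewrite -(leq_exp2r _ _ (e := 3)) //; apply: leq_trans h2.
  rewrite !expnMn (_ : 16 * h * t ^ 4 = 2 ^ 3 * (t ^ 3 * (2 * h * t)))%N.
    by rewrite !leq_mul2l B1 !orbT.
  by rewrite (expnSr t 3); lia.
set A := (t %/ B)%N; set D := ((B ^ 2).-1 %/ (2 * h))%N.
have AB : (A * B <= t)%N by exact: leq_trunc_div.
have AB1 : (t < A.+1 * B)%N by rewrite ltn_ceil //; lia.
have Bp : (0 < B ^ 2)%N by rewrite expn_gt0; lia.
have D1 : (2 * h * D < B ^ 2)%N.
  by have := leq_trunc_div (B ^ 2).-1 (2 * h); rewrite -/D mulnC; clear -Bp; lia.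
have D2 : (B ^ 2 <= 2 * h * D.+1)%N.
  have : ((B ^ 2).-1 < D.+1 * (2 * h))%N by rewrite ltn_ceil // muln_gt0.
  by rewrite mulnC; clear -Bp; lia.
have D0 : (0 < D)%N.
  have hB : (2 * h < B ^ 2)%N; last by rewrite lt0n; apply: contraTneq D2 => ->; lia.
  rewrite -(ltn_exp2r _ _ (e := 3)) // expnAC.
  have : ((16 * (h * t)) ^ 2 < (27 * B ^ 3) ^ 2)%N by rewrite ltn_exp2r.
  have : (h ^ 2 * (128 * h) <= h ^ 2 * t ^ 2)%N by rewrite leq_mul2l h1 orbT.
  have : (0 < h ^ 3)%N by rewrite expn_gt0 h0.
  rewrite !expnMn (expnSr h 2); move: (h ^ 2)%N (t ^ 2)%N ((B ^ 3) ^ 2)%N => x y z.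
  by rewrite mulnCA; clear; lia.
have DA : (D <= A)%N.
  rewrite leqNgt; apply/negP => ltAD.
  have ltD : (t < D * B)%N by apply: leq_trans AB1 _; rewrite leq_mul2r ltAD orbT.
  have : (2 * h * t < B ^ 3)%N; last by lia.
  apply: (@leq_trans (2 * h * (D * B))); first by rewrite ltn_pmul2l ?muln_gt0.
  by rewrite mulnA expnSr leq_mul2r (ltnW D1) orbT.
have tB1 : (t <= t * B)%N by rewrite leq_pmulr; lia.
have At : (A <= t)%N by apply: leq_div.
have ABp : (A + t * B <= p)%N by clear -At tB1 tB; lia.
have st := stepanov charF AB ABp DA D1.
have hd : (h * d <= #|fibres t P|)%N.
  by rewrite card_fibres -sum_nat_const; apply: leq_sum.
(* [12 = 3 * 4]: from [A + 2 t B <= 3 t B] and [B^2 <= 2 h (D + 1) <= 4 h D]. *)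
have dB : (d * B <= 12 * t)%N.
  rewrite -(leq_pmul2r (m := B)); last by lia.
  have e1 : (D * (h * d) <= 3 * (t * B))%N.
    apply: leq_trans (_ : D * #|fibres t P| <= _)%N; first by rewrite leq_mul2l hd orbT.
    apply: leq_trans st _; rewrite -mulnA.
    by move: At tB1; move: (t * B)%N => y; clear; lia.
  have e2 : (d * B ^ 2 <= d * (4 * (h * D)))%N.
    rewrite leq_mul2l; apply/orP; right; move: D2 D0; rewrite -mulnA; clear.
    by case: D => // D' + _; rewrite !mulnS; lia.
  by move: e1 e2; rewrite -mulnn; clear; lia.
have : ((d * B) ^ 3 <= (12 * t) ^ 3)%N by rewrite leq_exp2r.
have : (d ^ 3 * (16 * (h * t)) <= d ^ 3 * (27 * B ^ 3))%N.
  by rewrite leq_mul2l (ltnW BL) orbT.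
rewrite !expnMn => e1 e2.
rewrite -(leq_pmul2r (m := t)); last by lia.
move: e1 e2; rewrite (expnSr t 2); clear.
by move: (12 ^ 3)%N (d ^ 3)%N (B ^ 3)%N (t ^ 2)%N => c x y z; lia.
Qed.

(* Locked, so that this unary number is never computed. *)
Definition level_const : nat := locked (256 * (4 * 12 ^ 3))%N.

(** The factors [128] and [16] in [level_set_small] are removed by passing to a subset of [P] about
    [128] times smaller. If [#|P| < 128], a bound for [d] alone suffices: from one fibre when
    [t >= 16^3], and from [d <= t] otherwise. *)
Lemma level_set (P : {set F * F}) (d : nat) :
  (forall k, k \in P -> d <= #|fibres t [set k]|)%N ->
  (#|P| <= t ^ 2)%N -> (#|P| * t ^ 4 <= p ^ 3)%N -> (t ^ 3 <= p ^ 2)%N ->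
  (#|P| * d ^ 3 <= level_const * t ^ 2)%N.
Proof.
rewrite /level_const -lock; set c := (4 * 12 ^ 3)%N => dP h1 h2 ht.
have [P0|[k kP]] := set_0Vmem P; first by rewrite P0 cards0.
have sub_level (Q : {set F * F}) : Q \subset P ->
    (128 * #|Q| <= t ^ 2)%N -> (16 * #|Q| * t ^ 4 <= p ^ 3)%N ->
    (#|Q| * d ^ 3 <= c * t ^ 2)%N.
  by move/subsetP=> QP; apply: level_set_small => x /QP; apply: dP.
have [P128|P128] := leqP 128 #|P|.
  have [Q QP cQ] : exists2 Q : {set F * F}, Q \subset P & #|Q| = (#|P| %/ 128)%N.
    have : (#|P| %/ 128 <= #|P|)%N by exact: leq_div.
    move=> /card_geqP[s [us ss sP]]; exists [set x in s].
      by apply/subsetP => x; rewrite inE => /sP.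
    by rewrite cardsE (card_uniqP us) ss.
  have le1 : (128 * #|Q| <= #|P|)%N by rewrite cQ mulnC leq_trunc_div.
  have le2 : (#|P| <= 256 * #|Q|)%N by rewrite cQ; lia.
  have : (#|Q| * d ^ 3 <= c * t ^ 2)%N.
    apply: sub_level => //; first exact: leq_trans h1.
    apply: leq_trans h2; rewrite leq_mul2r; apply/orP; right; lia.
  rewrite -mulnA => /(leq_mul (leqnn 256)); apply: leq_trans.
  by rewrite mulnA leq_mul2r le2 orbT.
have : (d ^ 3 <= 2 * (c * t ^ 2))%N.
  have [t_small|t_large] := ltnP t (16 ^ 3).
    have dt : (d <= t)%N by apply: leq_trans (card_fibre_le k); exact: dP.
    apply: (@leq_trans (t ^ 3)); first by rewrite leq_exp2r.
    rewrite (expnSr t 2) mulnC mulnA leq_mul2r; apply/orP; right.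
    by apply: leq_trans (ltnW t_small) _; rewrite /c; lia.
  apply: leq_trans (leq_pmull _ _) => //.
  have := @sub_level [set k]; rewrite cards1 sub1set kP !muln1 mul1n; apply => //.
    apply: (@leq_trans ((16 ^ 3) ^ 2)); last by rewrite leq_exp2r.
    by lia.
  rewrite -(leq_exp2r _ _ (e := 3)) // expnMn.
  have tp : (t <= p)%N.
    rewrite leqNgt; apply/negP => ltpt.
    have : (p ^ 2 < t ^ 2)%N by rewrite ltn_exp2r.
    by rewrite ltnNge (leq_trans _ ht) // leq_pexp2l.
  apply: (@leq_trans (p * (p ^ 2) ^ 4)); last by rewrite -!expnM -expnS.
  apply: leq_mul; first exact: leq_trans tp.
  by rewrite -expnM mulnC -[(3 * 4)%N]/(3 * 4)%N expnM leq_exp2r.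
move=> /(leq_mul (ltnW P128)) /leq_trans; apply.
by rewrite -mulnA; lia.
Qed.
End LevelSets.

(** * Dyadic decomposition and second moments *)

Section NatSums.

(** The term with [2^i <= f < 2^(i+1)] suffices, whence [8 = 2^3]. *)
Lemma cube_le_dyadic (f m : nat) : (f < 2 ^ m)%N ->
  (f ^ 3 <= \sum_(i < m) (2 ^ i <= f) * (8 * (2 ^ i) ^ 3))%N.
Proof.
move=> ltf; have [->//|f0] := posnP f.
have [le1 le2] : (2 ^ trunc_log 2 f <= f)%N /\ (f < 2 ^ (trunc_log 2 f).+1)%N.
  by split; [exact: trunc_logP|exact: trunc_log_ltn].
have lti : (trunc_log 2 f < m)%N.
  by rewrite -(ltn_exp2l _ _ (m := 2)) //; exact: leq_ltn_trans ltf.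
rewrite (bigD1 (Ordinal lti)) //= le1 mul1n; apply: leq_trans (leq_addr _ _).
rewrite -[8%N]/(2 ^ 3)%N -expnMn leq_exp2r // -expnS; exact: ltnW.
Qed.

Lemma sqr_sum_le (I : finType) (A : {set I}) (a : I -> nat) :
  ((\sum_(i in A) a i) ^ 2 <= #|A| * \sum_(i in A) a i ^ 2)%N.
Proof.
rewrite -(leq_pmul2l (m := 2)) // -mulnn big_distrlr /= big_distrr /=.
apply: (@leq_trans (\sum_(i in A) \sum_(j in A) (a i ^ 2 + a j ^ 2))).
  apply: leq_sum => i _; rewrite big_distrr; apply: leq_sum => j _ /=.
  exact: nat_Cauchy.
under eq_bigr => i _ do rewrite big_split /= sum_nat_const.
rewrite big_split /= sum_nat_const -big_distrr /=; lia.
Qed.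

(** The second moment of the fibre sizes counts collisions of [h]; this turns energies into numbers
    of solutions of equations. *)
Lemma sum_card_preim (X Y : finType) (A : {set X}) (h : X -> Y) (P : pred Y) :
  (\sum_(y | P y) #|[set x in A | h x == y]| ^ 2 =
   #|[set z : X * X | [&& z.1 \in A, z.2 \in A, h z.1 == h z.2 & P (h z.1)]]|)%N.
Proof.
rewrite -sum1_card (partition_big (fun z : X * X => h z.1) P) /=; last first.
  by move=> z; rewrite inE => /and4P[].
apply: eq_bigr => y Py; rewrite -mulnn -cardsX -sum1_card.
apply: eq_bigl => -[x1 x2]; rewrite !inE /=.
have [e|_] := eqVneq (h x1) y; last by rewrite !andbF.
by rewrite e Py !andbT [y == _]eq_sym; case: (x1 \in A).
Qed.
End NatSums.

(** * The third moment of the fibre sizes *)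

Section CubeSums.
Variables (F : finFieldType) (p t : nat).
Hypotheses (charF : p \in [pchar F]) (t_gt0 : (0 < t)%N).

(** By [level_set], every dyadic range of fibre sizes contributes the same [O(t^2)]; the [m] ranges
    produce the logarithm. *)
Lemma sum_cube_fibres (K : {set F * F}) (m : nat) :
  (#|K| <= t ^ 2)%N -> (#|K| * t ^ 4 <= p ^ 3)%N -> (t ^ 3 <= p ^ 2)%N ->
  (t < 2 ^ m)%N ->
  (\sum_(k in K) #|fibres t [set k]| ^ 3 <= 8 * level_const * m * t ^ 2)%N.
Proof.
move=> h1 h2 h3 ltm.
apply: (@leq_trans (\sum_(k in K) \sum_(i < m)
    (2 ^ i <= #|fibres t [set k]|) * (8 * (2 ^ i) ^ 3))).
  apply: leq_sum => k _; apply: cube_le_dyadic.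
  exact: leq_ltn_trans (card_fibre_le t_gt0 k) ltm.
rewrite exchange_big /=.
apply: (@leq_trans (\sum_(i < m) 8 * (level_const * t ^ 2))); last first.
  by rewrite sum_nat_const card_ord; lia.
apply: leq_sum => i _; rewrite -big_distrl /= mulnCA leq_mul2l /=.
pose P := [set k in K | (2 ^ i <= #|fibres t [set k]|)%N].
have PK : (#|P| <= #|K|)%N by apply/subset_leq_card/subsetP => k; rewrite inE => /andP[].
have -> : (\sum_(k in K) (2 ^ i <= #|fibres t [set k]|) = #|P|)%N.
  rewrite -sum1_card [RHS]big_mkcond [LHS]big_mkcond /=; apply: eq_bigr => k _.
  by rewrite inE; case: (k \in K); case: leq.
apply: (level_set charF t_gt0) => //; first by move=> k; rewrite inE => /andP[].
  exact: leq_trans h1.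
by apply: leq_trans h2; rewrite leq_mul2r PK orbT.
Qed.
End CubeSums.

(** * Energies of the group of [t]-th roots of unity *)

Definition diff_count (F : finFieldType) (I : {set F}) (d : F) : nat :=
  #|[set x in I | x - d \in I]|.

(** The energy [E_3(I)]. *)
Definition energy3 (F : finFieldType) (I : {set F}) : nat :=
  (\sum_d diff_count I d ^ 3)%N.

Definition sum3 (V : nmodType) (z : V * V * V) : V := z.1.1 + z.1.2 + z.2.

(** The energy [T_3(I)]. *)
Definition additive_energy6 (F : finFieldType) (I : {set F}) : nat :=
  (\sum_s #|[set z in setX (setX I I) I | sum3 z == s]| ^ 2)%N.

Definition roots_of_unity (F : finFieldType) (t : nat) : {set F} :=
  [set x | x ^+ t == 1].

Section Energies.
Variables (F : finFieldType) (p t : nat).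
Hypotheses (charF : p \in [pchar F]) (cardF : #|F| = p) (t_gt0 : (0 < t)%N).
Let G := roots_of_unity F t.
Hypothesis cardG : #|G| = t.

Let inG x : (x \in G) = (x ^+ t == 1). Proof. by rewrite inE. Qed.

Let G_neq0 x : x \in G -> x != 0.
Proof. by rewrite inG; apply: contraTneq => ->; rewrite expr0n gtn_eqF // eq_sym oner_eq0. Qed.

Let GM x y : x \in G -> y \in G -> x * y \in G.
Proof. by rewrite !inG exprMn => /eqP-> /eqP->; rewrite mulr1. Qed.

Let GV x : x \in G -> x^-1 \in G.
Proof. by rewrite !inG exprVn => /eqP->; rewrite invr1. Qed.

(** Dividing by [d] embeds the representations of [d] into the fibre over [key d]. Each key belongs
    to at most [t] differences, so the sum over [d <> 0] is at most [t] times a third moment of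
    fibre sizes over [K], where [#|K| t] is at most both [t^2] and [p]. *)
Lemma energy3_roots_of_unity (m : nat) : (t ^ 3 <= p ^ 2)%N -> (t < 2 ^ m)%N ->
  (energy3 G <= (8 * level_const + 1) * m * t ^ 3)%N.
Proof.
move=> ht ltm.
have m0 : (0 < m)%N by case: m ltm => //; lia.
(* If [x] and [x - d] lie in [G], then [power_pair t (x / d)] depends on [d] only. *)
pose key (d : F) := (d^-1 ^+ t, (-1) ^+ t * d^-1 ^+ t).
pose N := [set d : F | (d != 0) && [exists x in G, x - d \in G]].
pose K := [set key d | d in N].
have keyG d x : x \in G -> key (d * x) = key d.
  by rewrite inG /key => /eqP xt; rewrite invfM exprMn (exprVn x) xt invr1 mulr1.
have cardN1 : (#|N| <= t ^ 2)%N.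
  rewrite -mulnn -cardG -cardsX.
  apply: leq_trans (leq_imset_card (fun z : F * F => z.1 - z.2) _).
  apply/subset_leq_card/subsetP => d; rewrite inE => /andP[_ /existsP[x /andP[xG xdG]]].
  by apply/imsetP; exists (x, x - d); rewrite ?in_setX ?xG //= subKr.
have cardN2 : (#|N| <= p)%N by rewrite -cardF; exact: max_card.
(* [N] is stable under multiplication by [G] and [key] is constant on cosets, so every key has at
   least [t] preimages. *)
have cardK : (#|K| * t <= #|N|)%N.
  rewrite -sum_nat_const -[#|N|]sum1_card.
  rewrite [leqRHS](partition_big key (mem K)) /=; last first.
    by move=> d dN; apply/imsetP; exists d.
  apply: leq_sum => k /imsetP[d dN ->]; rewrite sum1_card -cardG.
  have := dN; rewrite inE => /andP[d0 /existsP[x /andP[xG xdG]]].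
  rewrite -(card_imset (mem G) (mulfI d0)); apply/subset_leq_card/subsetP.
  move=> _ /imsetP[y yG ->]; rewrite -topredE /= inE keyG // eqxx andbT.
  rewrite mulf_neq0 ?(G_neq0 yG) //=.
  apply/existsP; exists (x * y).
  by rewrite GM //= -mulrBl GM.
have fibK k : (#|[set d in N | key d == k]| <= t)%N.
  rewrite -(card_imset _ invr_inj).
  apply: leq_trans (card_unity_roots_le t_gt0 k.1); apply/subset_leq_card/subsetP.
  by move=> _ /imsetP[d + ->]; rewrite !inE => /andP[_ /eqP <-].
have diffE d : d \in N -> (diff_count G d <= #|fibres t [set key d]|)%N.
  rewrite inE => /andP[d0 _].
  rewrite /diff_count -(card_imset _ (mulIf (invr_neq0 d0))).
  apply/subset_leq_card/subsetP => _ /imsetP[x + ->].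
  rewrite !inE => /andP[xG xdG].
  have x0 : x != 0 by apply: G_neq0; rewrite inE.
  have xd0 : x - d != 0 by apply: G_neq0; rewrite inE.
  have -> : power_pair t (x / d) = key d.
    have e : 1 - x / d = - 1 * (x - d) * d^-1 by field.
    by rewrite /power_pair e /key !exprMn (eqP xG) (eqP xdG) mul1r mulr1.
  rewrite eqxx andbT mulf_neq0 ?invr_eq0 //=.
  by apply: contra_neq xd0 => e; rewrite -[x](divfK d0) e mul1r subrr.
have cK : (#|K| <= t)%N.
  rewrite -(leq_pmul2r (m := t)) //; apply: leq_trans cardK _.
  by rewrite mulnn.
have sumK := @sum_cube_fibres F p t charF t_gt0 K m _ _ ht ltm.
(* The term [d = 0] is at most [t^3], whence the [+ 1] in the constant. *)
rewrite /energy3 (bigD1 0) //= mulnDl mulnDl mul1n addnC; apply: leq_add; last first.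
  rewrite (leq_trans _ (leq_pmull _ m0)) // leq_exp2r // -cardG.
  by apply/subset_leq_card/subsetP => x; rewrite inE => /andP[].
apply: (@leq_trans (\sum_(d in N) #|fibres t [set key d]| ^ 3)).
  rewrite big_mkcond [leqRHS]big_mkcond /=; apply: leq_sum => d _.
  case: ifP => // d0; case: ifP => [dN|]; first by rewrite leq_exp2r // diffE.
  rewrite inE d0 /= => /negbT/existsPn noG; rewrite leqn0 expn_eq0 andbT cards_eq0.
  by apply/eqP/setP => x; rewrite in_set0 inE; exact/negbTE/noG.
rewrite (partition_big key (mem K)) /=; last by move=> d dN; apply/imsetP; exists d.
apply: (@leq_trans (\sum_(k in K) t * #|fibres t [set k]| ^ 3)).
  apply: leq_sum => k _.
  rewrite (eq_bigr (fun=> #|fibres t [set k]| ^ 3)%N); last by move=> d /andP[_ /eqP->].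
  rewrite sum_nat_const leq_mul2r; apply/orP; right; apply: leq_trans (fibK k).
  by rewrite cardsE.
rewrite -big_distrr /= (expnS t 2) [leqRHS]mulnCA leq_mul2l; apply/orP; right.
apply: sumK; first by apply: leq_trans cK _; rewrite -mulnn leq_pmulr.
apply: (@leq_trans (p * p ^ 2)); last by rewrite -expnS.
by rewrite (expnS t 3) mulnA leq_mul // (leq_trans cardK).
Qed.

Let prod3 (z : F * F * F) : F := z.1.1 * z.1.2 * z.2.
Let G3 := setX (setX G G) G.
Let sols6 := [set z : (F * F * F) * (F * F * F) |
  [&& z.1 \in G3, z.2 \in G3, sum3 z.1 == sum3 z.2 & prod3 z.1 == prod3 z.2]].

(** The product takes only [t] values, so Cauchy-Schwarz costs a factor [t]. *)
Let energy6_le_sols6 : (additive_energy6 G <= t * #|sols6|)%N.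
Proof.
pose h z := (sum3 z, prod3 z).
pose r s q := #|[set z in G3 | h z == (s, q)]|.
have rE s : #|[set z in G3 | sum3 z == s]| = (\sum_(q in G) r s q)%N.
  rewrite -sum1_card (partition_big prod3 (mem G)) /=; last first.
    move=> [[a b] c]; rewrite inE /G3 !in_setX => /andP[/andP[/andP[? ?] ?] _].
    by rewrite /prod3 !GM.
  apply: eq_bigr => q _; rewrite /r -sum1_card; apply: eq_bigl => z.
  by rewrite !inE /h xpair_eqE -!andbA.
have sols6E : #|sols6| = (\sum_s \sum_q r s q ^ 2)%N.
  rewrite pair_bigA /= (eq_bigr (fun y => #|[set z in G3 | h z == y]| ^ 2)%N); last by case.
  rewrite sum_card_preim; apply: eq_card => z; rewrite !inE /= /h xpair_eqE.
  by rewrite andbT.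
rewrite sols6E big_distrr; apply: leq_sum => s _; rewrite rE.
apply: leq_trans (sqr_sum_le _ _) _; rewrite cardG leq_mul2l; apply/orP; right.
by rewrite [leqRHS](bigID (mem G)) /= leq_addr.
Qed.

Let quads := [set z : (F * F) * (F * F) |
  [&& z.1 \in setX G G, z.2 \in setX G G &
      (z.1.1 - 1) * (z.2.2 - 1) == (z.1.2 - 1) * (z.2.1 - 1)]].

(* With [c_1 = y_1 / x_1], [c_2 = x_2 / y_2], [b_1 = y_1 y_2 / (x_1 x_3)] and
   [b_2 = y_1 / x_3], the two equations of [sols6] amount to the one of [quads]. *)
Let sols6_le_quads : (#|sols6| <= t * #|quads|)%N.
Proof.
pose phi (z : (F * F * F) * (F * F * F)) :=
  let: ((x1, x2, x3), (y1, y2, y3)) := z in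
  (x3, ((y1 / x1, x2 / y2), (y1 * y2 / (x1 * x3), y1 / x3))).
(* The image gives back [x3], [y1], [x1], [y2], [x2] in this order, and then the product equation
   gives [y3]. *)
have phi_inj : {in sols6 &, injective phi}.
  move=> [[[x1 x2] x3] [[y1 y2] y3]] [[[u1 u2] u3] [[v1 v2] v3]].
  rewrite !inE /sum3 /prod3 /= -!inG.
  move=> /and4P[/andP[/andP[x1G x2G] x3G] /andP[/andP[y1G y2G] y3G] _ /eqP e1].
  move=> /and4P[/andP[/andP[u1G u2G] u3G] /andP[/andP[v1G v2G] v3G] _ /eqP e2].
  move: x1G x2G x3G y1G y2G y3G u1G u2G u3G v1G v2G v3G.
  do 12!move=> /G_neq0 ?.
  case=> e3 e4 e5 e6 e7; rewrite -{}e3 in e2 e6 e7 *.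
  have ey1 : y1 = v1 by apply: (mulIf (invr_neq0 _)) e7.
  rewrite -{}ey1 in e2 e4 e6 *.
  have ex1 : x1 = u1 by apply/invr_inj/(mulfI _ e4).
  rewrite -{}ex1 in e2 e6 *.
  have ey2 : y2 = v2.
    by apply: (mulfI _ (mulIf _ e6)) => //; rewrite invr_eq0 mulf_neq0.
  rewrite -{}ey2 in e2 e5 *.
  have ex2 : x2 = u2 by apply: (mulIf (invr_neq0 _)) e5.
  rewrite -{}ex2 in e2 *.
  suff -> : y3 = v3 by [].
  by apply: (mulfI (_ : y1 * y2 != 0)); rewrite ?mulf_neq0 // -e1 -e2.
rewrite -(card_in_imset phi_inj) -cardG -cardsX; apply/subset_leq_card/subsetP.
move=> _ /imsetP[[[[x1 x2] x3] [[y1 y2] y3]] + ->].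
rewrite inE /G3 !in_setX /sum3 /prod3 /=.
move=> /and4P[/andP[/andP[x1G x2G] x3G] /andP[/andP[y1G y2G] y3G] /eqP e1 /eqP e2].
rewrite x3G inE !in_setX /= !GM ?GV ?GM //=.
have x10 := G_neq0 x1G; have x30 := G_neq0 x3G; have y20 := G_neq0 y2G.
rewrite -subr_eq0; apply/eqP.
transitivity ((y1 * y2 * (y1 + y2 + y3 - (x1 + x2 + x3)) +
  (x1 * x2 * x3 - y1 * y2 * y3)) / (x1 * x3 * y2)).
  by field; rewrite y20 x30.
by rewrite e1 e2 !subrr mulr0 addr0 mul0r.
Qed.

Let A := setX (G :\ 1) (G :\ 1).
Let ratio (c : F * F) := (c.1 - 1) / (c.2 - 1).
Let rho (w : F) := #|[set c in A | ratio c == w]|.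

(** If the common product vanishes, two coordinates equal [1]: four families of at most [t^2]
    solutions. Otherwise [c] and [b] lie in [A] and have the same nonzero [ratio]. *)
Let quads_le_rho : (#|quads| <= 4 * t ^ 2 + \sum_(w | w != 0%R) rho w ^ 2)%N.
Proof.
rewrite sum_card_preim; set Q := [set z | _].
pose im (f : F * F -> (F * F) * (F * F)) := f @: setX G G.
have card_im f : (#|im f| <= t ^ 2)%N.
  by apply: leq_trans (leq_imset_card _ _) _; rewrite cardsX cardG mulnn.
pose D1 := im (fun x => ((1, 1), (x.1, x.2))).
pose D2 := im (fun x => ((1, x.1), (1, x.2))).
pose D3 := im (fun x => ((x.1, 1), (x.2, 1))).
pose D4 := im (fun x => ((x.1, x.2), (1, 1))).
have sub : quads \subset D1 :|: D2 :|: D3 :|: D4 :|: Q.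
  apply/subsetP => -[[c1 c2] [b1 b2]]; rewrite 2!inE !in_setX /=.
  move=> /and3P[/andP[c1G c2G] /andP[b1G b2G] /eqP e]; rewrite !in_setU.
  have inim f x y : x \in G -> y \in G -> f (x, y) \in im f.
    by move=> xG yG; apply/imsetP; exists (x, y); rewrite ?in_setX ?xG.
  have [z0|nz] := eqVneq ((c1 - 1) * (b2 - 1)) 0.
    move: e; rewrite z0 => /esym/eqP; rewrite mulf_eq0.
    move/eqP: z0; rewrite mulf_eq0 !subr_eq0.
    case/orP=> /eqP e1; case/orP=> /eqP e2; rewrite e1 e2.
    - by rewrite (inim (fun x => ((1, 1), (x.1, x.2))) b1 b2).
    - by rewrite (inim (fun x => ((1, x.1), (1, x.2))) c2 b2) ?orbT.
    - by rewrite (inim (fun x => ((x.1, 1), (x.2, 1))) c1 b1) ?orbT.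
    - by rewrite (inim (fun x => ((x.1, x.2), (1, 1))) c1 c2) ?orbT.
  have nz' := nz; rewrite e in nz'; move: nz nz'; rewrite !mulf_eq0 !negb_or.
  move=> /andP[n1 n2] /andP[n3 n4].
  apply/orP; right; rewrite /Q inE /A !in_setX !in_setD1 /= c1G c2G b1G b2G.
  rewrite -![_ == 1 :> F]subr_eq0 n1 n2 n3 n4 /= /ratio /= mulf_neq0 ?invr_eq0 // andbT.
  by rewrite eqr_div // e mulrC.
apply: leq_trans (subset_leq_card sub) _.
apply: leq_trans (leq_card_setU _ _) _; rewrite leq_add2r.
apply: leq_trans (leq_card_setU _ _) _; rewrite [(4 * _)%N]mulSnr.
apply: (leq_add _ (card_im _)).
apply: leq_trans (leq_card_setU _ _) _; rewrite [(3 * _)%N]mulSnr.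
apply: (leq_add _ (card_im _)).
apply: leq_trans (leq_card_setU _ _) _; rewrite mul2n -addnn.
exact: (leq_add (card_im _) (card_im _)).
Qed.

Let K := [set k : F * F | (1 < #|fibres t [set k]|)%N].

(** Two distinct points [v], [u] of a fibre give [c_1 = u / v] and [c_2 = (1 - u) / (1 - v)] in [G],
    with [c_1 <> c_2] and [v (c_1 - c_2) = 1 - c_2]. So [(c_1, c_2)] determines [v], hence the
    fibre. *)
Let card_K : (#|K| <= t ^ 2)%N.
Proof.
pose pair k := odflt (0, 0) [pick z : F * F |
  [&& z.1 \in fibres t [set k], z.2 \in fibres t [set k] & z.1 != z.2]].
have pairP k : k \in K -> [/\ (pair k).1 \in fibres t [set k],
    (pair k).2 \in fibres t [set k] & (pair k).1 != (pair k).2].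
  rewrite inE => /card_gt1P[x [y [xk yk ne]]]; rewrite /pair.
  by case: pickP => [z /and3P[]//|/(_ (x, y))]; rewrite /= xk yk ne.
pose psi k := ((pair k).2 / (pair k).1, (1 - (pair k).2) / (1 - (pair k).1)).
have sol k : k \in K -> [/\ psi k \in setX G G,
    (pair k).1 * ((psi k).1 - (psi k).2) = 1 - (psi k).2,
    (psi k).1 != (psi k).2 & power_pair t (pair k).1 = k].
  move=> kK; have [] := pairP k kK; rewrite /psi; case: (pair k) => v u /=.
  rewrite !inE => /and3P[v0 v1 /eqP <-] /and3P[u0 u1 /eqP[e1 e2]] ne.
  have v1' : 1 - v != 0 by rewrite subr_eq0 eq_sym.
  have ne' : u / v != (1 - u) / (1 - v).
    rewrite eqr_div // -subr_eq0.
    rewrite (_ : _ - _ = u - v); first by rewrite subr_eq0 eq_sym.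
    by ring.
  split => //.
    rewrite !expr_div_n e1 e2 !divff ?expf_neq0 // ?eqxx //.
  by field; rewrite v0 v1'.
have psi_inj : {in K &, injective psi}.
  move=> k k' /sol[_ e1 ne e3] /sol[_ e2 _ e4] e; rewrite -e3 -e4; congr power_pair.
  apply: (mulIf (_ : (psi k).1 - (psi k).2 != 0)); first by rewrite subr_eq0.
  by rewrite e1 e -e2.
rewrite -(card_in_imset psi_inj) -mulnn -cardG -cardsX.
by apply/subset_leq_card/subsetP => _ /imsetP[k /sol[? _ _ _] ->].
Qed.

(* [c_1 - 1 = w (c_2 - 1)] with [w = 1 - 1 / v] says that [c_1 v + (1 - v) c_2 = 1];
   the trivial solution [c_1 = c_2 = 1], excluded from [A], makes this strict. *)
Let rho_lt (v : F) : v != 0 -> v != 1 ->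
  (rho (1 - v^-1)%R < #|fibres t [set power_pair t v]|)%N.
Proof.
move=> v0 v1; set W := fibres t _.
have vW : v \in W by rewrite !inE v0 v1 eqxx.
rewrite (cardsD1 v) vW add1n ltnS.
pose f (c : F * F) := c.1 * v.
have v1' : v - 1 != 0 by rewrite subr_eq0.
have rel c : c \in A -> ratio c = 1 - v^-1 -> 1 - f c = (1 - v) * c.2.
  rewrite /A !inE => /and3P[/andP[_ c1] c2 _]; rewrite /ratio /f => e.
  have c2' : c.2 - 1 != 0 by rewrite subr_eq0.
  have -> : c.1 = 1 + (1 - v^-1) * (c.2 - 1) by rewrite -e divfK //; ring.
  by field.
have f_inj : {in [set c in A | ratio c == 1 - v^-1] &, injective f}.
  move=> c c'; rewrite inE => /andP[cA /eqP ec]; rewrite inE => /andP[cA' /eqP ec'] e.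
  have e1 : c.1 = c'.1 by apply: (mulIf v0) e.
  have e2 : c.2 = c'.2.
    by apply: (mulfI (_ : 1 - v != 0)); rewrite ?subr_eq0 1?eq_sym // -(rel c) // -(rel c') // e.
  by case: c c' e1 e2 {e cA cA' ec ec'} => [? ?] [? ?] /= -> ->.
rewrite /rho -(card_in_imset f_inj); apply/subset_leq_card/subsetP => _ /imsetP[c + ->].
rewrite inE => /andP[cA /eqP ec]; have r := rel c cA ec.
move: cA; rewrite /A !inE -!inG => /andP[/andP[c11 c1G] /andP[_ c2G]].
have fv : f c != v by apply: contra_neq c11 => e; apply: (mulIf v0); rewrite mul1r.
have f0 : f c != 0 by rewrite /f mulf_neq0 ?(G_neq0 c1G).
rewrite fv f0 /=; apply/andP; split.
  by rewrite eq_sym -subr_eq0 r mulf_neq0 ?(G_neq0 c2G) // subr_eq0 eq_sym.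
move: c1G c2G; rewrite !inG /power_pair r !exprMn => /eqP-> /eqP->.
by rewrite mul1r mulr1.
Qed.

(** By [rho_lt], the sum of [rho^2] over a fibre is at most the cube of its size, so
    [sum_cube_fibres] applies; [t^2 <= p] yields [#|K| t^4 <= t^6 <= p^3]. The [5] in the constant
    is [4] from [quads_le_rho] plus [1] for [w = 1]. *)
Lemma additive_energy6_roots_of_unity (m : nat) : (t ^ 2 <= p)%N -> (t < 2 ^ m)%N ->
  (additive_energy6 G <= (8 * level_const + 5) * m * t ^ 4)%N.
Proof.
move=> ht ltm.
have m0 : (0 < m)%N by case: m ltm => //; lia.
apply: leq_trans energy6_le_sols6 _.
apply: (@leq_trans (t * (t * ((8 * level_const + 5) * m * t ^ 2)))); last first.
  by rewrite [X in (t * X)%N]mulnCA mulnCA -!expnS.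
rewrite leq_mul2l; apply/orP; right; apply: leq_trans sols6_le_quads _.
rewrite leq_mul2l; apply/orP; right; apply: leq_trans quads_le_rho _.
(* With [0^-1 = 0], [w = 1 - 1 / v] permutes the whole field; [v = 0] stands for [w = 1], where
   [c_1 = c_2]. *)
have inj : injective (fun v : F => 1 - v^-1).
  by move=> u v /addrI/oppr_inj/invr_inj.
rewrite (reindex_inj inj) /= (bigD1 0) ?invr0 ?subr0 ?oner_eq0 //=.
have rho1 : (rho 1%R ^ 2 <= t ^ 2)%N.
  rewrite leq_exp2r // -cardG /rho.
  rewrite -(card_in_imset (_ : {in [set c in A | ratio c == 1] &, injective (@fst F F)})).
    apply/subset_leq_card/subsetP => _ /imsetP[c + ->]; rewrite !inE.
    by move=> /andP[/andP[/andP[_ ?] _] _].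
  have rc c : c \in [set c in A | ratio c == 1] -> c.1 = c.2.
    rewrite !inE => /andP[/andP[_ /andP[c2 _]] /eqP e].
    have c2' : c.2 - 1 != 0 by rewrite subr_eq0.
    by apply: (addIr (-1)); apply: (mulIf (invr_neq0 c2')); rewrite divff.
  move=> c c' /rc e /rc e'; case: c c' e e' => [? ?] [? ?] /= -> -> /= -> //.
suff le : (\sum_(v | (1 - v^-1 != 0)%R && (v != 0)%R) rho (1 - v^-1)%R ^ 2 <=
           8 * level_const * m * t ^ 2)%N.
  have mt : (t ^ 2 <= m * t ^ 2)%N by rewrite leq_pmull.
  rewrite mulnDl mulnDl -(mulnA 5) addnA [leqRHS]addnC; apply: leq_add le.
  by apply: leq_trans (leq_add (leqnn _) rho1) _; lia.
have t3 : (t ^ 3 <= p ^ 2)%N.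
  apply: (@leq_trans ((t ^ 2) ^ 2)); last by rewrite leq_exp2r.
  by rewrite -expnM leq_pexp2l.
have Kp : (#|K| * t ^ 4 <= p ^ 3)%N.
  apply: (@leq_trans (t ^ 2 * t ^ 4)); first by rewrite leq_mul2r card_K orbT.
  by rewrite -expnD -[(2 + 4)%N]/(2 * 3)%N expnM leq_exp2r.
apply: leq_trans (sum_cube_fibres charF t_gt0 card_K Kp t3 ltm).
apply: (@leq_trans (\sum_(v in fibres t K) #|fibres t [set power_pair t v]| ^ 2)).
  rewrite big_mkcond [leqRHS]big_mkcond /=; apply: leq_sum => v _.
  case: ifP => // /andP[v1 v0].
  have v1' : v != 1 by apply: contra_neq v1 => ->; rewrite invr1 subrr.
  have lt := rho_lt v0 v1'; case: ifP => [_|].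
    by rewrite leq_exp2r // ltnW.
  rewrite !inE v0 v1' /= => /negbT; rewrite -leqNgt => le1.
  by have := leq_trans lt le1; rewrite ltnS leqn0 => /eqP->.
rewrite (partition_big (power_pair t) (mem K)) /=; last first.
  by move=> v; rewrite inE => /and3P[].
apply: leq_sum => k kK.
rewrite (eq_bigr (fun=> #|fibres t [set k]| ^ 2)%N); last by move=> v /andP[_ /eqP->].
rewrite sum_nat_const (expnS _ 2) leq_mul2r; apply/orP; right.
apply/subset_leq_card/subsetP => v; rewrite -topredE /= !inE.
by move=> /andP[/and3P[-> -> _] ->].
Qed.
End Energies.

(** * Cauchy-Schwarz and power mean inequalities *)

Section PowerMeans.
Variable C : numFieldType.

Lemma sqr_ge0_of_ge0 (a b : C) : 0 <= a -> 0 <= b -> 0 <= (a - b) ^+ 2.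
Proof.
move=> a0 b0; apply: real_exprn_even_ge0 => //.
by apply: rpredB; apply: ger0_real.
Qed.

(** Lagrange's identity: twice the defect is the sum of the [(a i * b j - a j * b i)^2]. *)
Lemma cauchy_schwarz_ge0 (I : finType) (A : {pred I}) (a b : I -> C) :
  (forall i, i \in A -> 0 <= a i) -> (forall i, i \in A -> 0 <= b i) ->
  (\sum_(i in A) a i * b i) ^+ 2 <=
    (\sum_(i in A) a i ^+ 2) * (\sum_(i in A) b i ^+ 2).
Proof.
move=> a0 b0; rewrite -subr_ge0 -(pmulrn_lge0 _ (isT : (0 < 2)%N)).
set x := \sum_(i in A) a i * b i; set y := \sum_(i in A) a i ^+ 2.
set z := \sum_(i in A) b i ^+ 2.
have -> : (y * z - x ^+ 2) *+ 2 =
    \sum_(i in A) \sum_(j in A) (a i * b j - a j * b i) ^+ 2.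
  transitivity (\sum_(i in A) (a i ^+ 2 * z + b i ^+ 2 * y - (a i * b i * x) *+ 2)).
    rewrite sumrB big_split /= -!mulr_suml -/y -/z sumrMnl -mulr_suml -/x; ring.
  apply: eq_bigr => i _; rewrite /x /y /z !mulr_sumr -sumrMnl -big_split -sumrB /=.
  by apply: eq_bigr => j _; ring.
apply: sumr_ge0 => i Ai; apply: sumr_ge0 => j Aj.
by apply: sqr_ge0_of_ge0; rewrite mulr_ge0 ?a0 ?b0.
Qed.

Lemma cube_weighted_mean (I : finType) (A : {pred I}) (w a : I -> C) :
  (forall i, i \in A -> 0 <= w i) -> (forall i, i \in A -> 0 <= a i) ->
  (\sum_(i in A) w i * a i) ^+ 3 <=
    (\sum_(i in A) w i) ^+ 2 * (\sum_(i in A) w i * a i ^+ 3).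
Proof.
move=> w0 a0; set W := \sum_(i in A) w i; set S := \sum_(i in A) _.
have S0 : 0 <= S by apply: sumr_ge0 => i Ai; rewrite mulr_ge0 ?w0 ?a0.
have [W0|W0] := eqVneq W 0.
  have wi0 i : i \in A -> w i = 0.
    move=> Ai; apply/eqP; move/eqP: W0; rewrite /W psumr_eq0 //.
    by move=> /allP/(_ i (mem_index_enum i)); rewrite Ai.
  rewrite W0 expr0n /= mul0r /S big1 ?expr0n // => i /wi0 ->.
  by rewrite mul0r.
have Wge0 : 0 <= W by apply: sumr_ge0.
have Wgt0 : 0 < W by rewrite lt_def W0.
pose m := S / W.
have m0 : 0 <= m by rewrite divr_ge0.
(* the tangent line of the cube at the mean [m] *)
have tangent x : 0 <= x -> 3 * m ^+ 2 * x - 2 * m ^+ 3 <= x ^+ 3.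
  move=> x0; rewrite -subr_ge0 (_ : _ - _ = (x - m) ^+ 2 * (x + 2 * m)); last by ring.
  by rewrite mulr_ge0 ?sqr_ge0_of_ge0 // addr_ge0 // mulr_ge0.
have : \sum_(i in A) w i * (3 * m ^+ 2 * a i - 2 * m ^+ 3) <= \sum_(i in A) w i * a i ^+ 3.
  by apply: ler_sum => i Ai; rewrite ler_wpM2l ?w0 ?tangent ?a0.
move=> /(ler_wpM2l (exprn_ge0 2 Wge0)); apply: le_trans.
rewrite (eq_bigr (fun i => 3 * m ^+ 2 * (w i * a i) - 2 * m ^+ 3 * w i)); last first.
  by move=> i _; ring.
rewrite sumrB -!mulr_sumr -/S -/W /m le_eqVlt; apply/orP; left; apply/eqP.
by field.
Qed.
End PowerMeans.

(** * Bilinear forms with an orthogonal kernel *)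

Section Bilinear.
Variables (C : numClosedFieldType) (X Y : finType) (kappa : X -> Y -> C) (q : C).
Hypothesis orth : forall y z, \sum_x kappa x y * (kappa x z)^* = q * (y == z)%:R.

Lemma parseval_kernel (f : Y -> C) :
  \sum_x `|\sum_y f y * kappa x y| ^+ 2 = q * \sum_y `|f y| ^+ 2.
Proof.
transitivity (\sum_x \sum_y \sum_z f y * (f z)^* * (kappa x y * (kappa x z)^*)).
  apply: eq_bigr => x _; rewrite normCK rmorph_sum mulr_suml; apply: eq_bigr => y _.
  by rewrite mulr_sumr; apply: eq_bigr => z _; rewrite rmorphM /=; ring.
rewrite exchange_big mulr_sumr; apply: eq_bigr => y _ /=.
rewrite exchange_big (bigD1 y) //= -mulr_sumr orth eqxx big1 => [|z ne].
  by rewrite normCK mulr1 addr0 mulrC.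
by rewrite -mulr_sumr orth eq_sym (negPf ne) !mulr0.
Qed.

(** Grouping by the values of [alpha] and [beta] gives a bilinear form in their multiplicities; then
    Cauchy-Schwarz over [x] and Parseval. The maps are [id] for plain sums and [shifts3] for the
    trace. *)
Lemma bilinear_le (S T : finType) (A : {set S}) (B : {set T})
    (alpha : S -> X) (beta : T -> Y) :
  `|\sum_(a in A) \sum_(b in B) kappa (alpha a) (beta b)| ^+ 2 <=
    q * (\sum_x #|[set a in A | alpha a == x]| ^ 2)%:R
      * (\sum_y #|[set b in B | beta b == y]| ^ 2)%:R.
Proof.
pose f x := #|[set a in A | alpha a == x]|; pose h y := #|[set b in B | beta b == y]|.
have -> : \sum_(a in A) \sum_(b in B) kappa (alpha a) (beta b) =
    \sum_x (f x)%:R * \sum_y (h y)%:R * kappa x y.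
  rewrite (partition_big alpha predT) //=; apply: eq_bigr => x _.
  rewrite (eq_bigr (fun=> \sum_y (h y)%:R * kappa x y)); last first.
    move=> a /andP[_ /eqP ->]; rewrite (partition_big beta predT) //=.
    apply: eq_bigr => y _; rewrite (eq_bigr (fun=> kappa x y)); last by move=> b /andP[_ /eqP->].
    by rewrite sumr_const mulr_natl /h cardsE.
  by rewrite sumr_const mulr_natl /f cardsE.
apply: (@le_trans _ _ ((\sum_x (f x)%:R * `|\sum_y (h y)%:R * kappa x y|) ^+ 2)).
  rewrite lerXn2r ?nnegrE // ?sumr_ge0 // => [x _|]; first by rewrite mulr_ge0.
  by apply: le_trans (ler_norm_sum _ _ _) _; apply: ler_sum => x _; rewrite normrM normr_nat.
apply: le_trans (cauchy_schwarz_ge0 _ _) _ => //.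
rewrite parseval_kernel mulrA -/f -/h [q * _]mulrC !natr_sum.
rewrite le_eqVlt; apply/orP; left; apply/eqP; congr (_ * _ * _).
  by apply: eq_bigr => x _; rewrite natrX.
by apply: eq_bigr => y _; rewrite natrX normr_nat.
Qed.
End Bilinear.

Lemma diff_count_mono (F : finFieldType) (I J : {set F}) d :
  I \subset J -> (diff_count I d <= diff_count J d)%N.
Proof.
move/subsetP=> IJ; apply/subset_leq_card/subsetP => x.
by rewrite !inE => /andP[/IJ-> /IJ->].
Qed.

Lemma energy3_mono (F : finFieldType) (I J : {set F}) :
  I \subset J -> (energy3 I <= energy3 J)%N.
Proof. by move=> IJ; apply: leq_sum => d _; rewrite leq_exp2r // diff_count_mono. Qed.

Lemma additive_energy6_mono (F : finFieldType) (I J : {set F}) :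
  I \subset J -> (additive_energy6 I <= additive_energy6 J)%N.
Proof.
move/subsetP=> IJ; apply: leq_sum => s _; rewrite leq_exp2r //.
apply/subset_leq_card/subsetP => -[[x y] z]; rewrite !inE /=.
by move=> /andP[/andP[/andP[/IJ-> /IJ->] /IJ->] ->].
Qed.

Lemma card_eq_in (T : finType) (A : {set T}) (x : T) :
  #|[set a in A | a == x]| = (x \in A).
Proof.
have [xA|xA] := boolP (x \in A); last first.
  apply/eqP; rewrite cards_eq0; apply/eqP/setP => a; rewrite !inE.
  by apply/negbTE/negP => /andP[aA /eqP e]; rewrite e (negPf xA) in aA.
rewrite -[RHS](cards1 x); congr #|pred_of_set _|; apply/setP => a; rewrite !inE.
by have [->|] := eqVneq a x; rewrite ?xA ?andbF.
Qed.

Lemma sum_sqr_card_eq (T : finType) (A : {set T}) :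
  (\sum_x #|[set a in A | a == x]| ^ 2 = #|A|)%N.
Proof.
rewrite -sum1_card [RHS]big_mkcond; apply: eq_bigr => x _.
by rewrite card_eq_in; case: (x \in A).
Qed.

Lemma sum_pair_setX (C : nmodType) (S T : finType) (A : {set S}) (B : {set T})
    (f : S -> T -> C) :
  \sum_(x in A) \sum_(y in B) f x y = \sum_(z in setX A B) f z.1 z.2.
Proof. by rewrite pair_big; apply: eq_bigl => -[x y] /=; rewrite in_setX. Qed.

Lemma sum_setX (C : comPzRingType) (S T : finType) (A : {set S}) (B : {set T})
    (f : S -> C) (g : T -> C) :
  (\sum_(x in A) f x) * (\sum_(y in B) g y) =
  \sum_(z in setX A B) f z.1 * g z.2.
Proof. by rewrite big_distrlr sum_pair_setX. Qed.

Lemma sum_cube (C : comPzRingType) (T : finType) (A : {set T}) (a : T -> C) :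
  (\sum_(x in A) a x) ^+ 3 =
  \sum_(z in setX (setX A A) A) a z.1.1 * a z.1.2 * a z.2.
Proof. by rewrite exprSr expr2 !sum_setX. Qed.

Definition shifts3 (F : zmodType) (z : F * F * F) : F * F := (z.1.1 - z.1.2, z.2 - z.1.1).

(** Two triples with equal [shifts3] differ by a common translation [s]; for given [s], each entry
    of the first triple has [diff_count I s] choices. *)
Lemma shifts3_energy (F : finFieldType) (I : {set F}) :
  (\sum_d #|[set z in setX (setX I I) I | shifts3 z == d]| ^ 2 <= energy3 I)%N.
Proof.
rewrite sum_card_preim -sum1_card.
rewrite (partition_big (fun z : (F * F * F) * (F * F * F) => z.1.1.1 - z.2.1.1) predT) //=.
apply: leq_sum => s _; rewrite sum1_card.
pose D := [set x in I | x - s \in I].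
rewrite (_ : diff_count I s ^ 3 = #|setX (setX D D) D|)%N; last first.
  by rewrite !cardsX /diff_count -/D; lia.
have inj : {in [pred z : (F * F * F) * (F * F * F) | (shifts3 z.1 == shifts3 z.2) &&
    (z.1.1.1 - z.2.1.1 == s)] &, injective (@fst (F * F * F) (F * F * F))}.
  move=> [[[a b] c] [[a' b'] c']] [[[u v] w] [[u' v'] w']]; rewrite !inE /shifts3 /= !xpair_eqE.
  move=> /andP[/andP[/eqP e1 /eqP e2] /eqP e3] /andP[/andP[/eqP e4 /eqP e5] /eqP e6].
  case=> ea eb ec; rewrite -ea -eb -ec in e4 e5 e6 *.
  have ea' : a' = u' by rewrite -[a'](subKr a) e3 -e6; ring.
  rewrite -ea' in e4 e5 *.
  have -> : b' = v' by apply: oppr_inj; apply: (addrI a'); rewrite -e1 -e4.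
  by have -> : c' = w' by apply: (addIr (- a')); rewrite -e2 -e5.
rewrite -(card_in_imset (sub_in2 _ inj)); last first.
  by move=> z; rewrite -!topredE /= !inE => /andP[/and4P[_ _ -> _] ->].
apply/subset_leq_card/subsetP => _ /imsetP[[[[a b] c] [[a' b'] c']] + ->].
rewrite -topredE /= !inE /shifts3 /= xpair_eqE !andbT.
move=> /andP[/and3P[/andP[/andP[-> ->] ->] /andP[/andP[a1 b1] c1] /andP[/eqP e1 /eqP e2]] /eqP e3].
have -> : a - s = a' by rewrite -e3 subKr.
have -> : b - s = b' by rewrite -e3 -[b](subKr a) e1; ring.
have -> : c - s = c' by rewrite -e3 -[c](subrK a) e2; ring.
by rewrite a1 b1 c1.
Qed.

(** * Bilinear character sums bounded by energies *)

Section CharacterSums.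
Variables (C : numClosedFieldType) (F : finFieldType) (p : nat) (psi : F -> C).
Hypothesis cardF : #|F| = p.
Hypothesis psiD : forall x y, psi (x + y) = psi x * psi y.
Hypothesis psi_norm : forall x, `|psi x| = 1.
Hypothesis psi_sum : forall a, a != 0 -> \sum_x psi (x * a) = 0.

Let psi_conj x : (psi x)^* = psi (- x).
Proof.
have nz y : psi y != 0 by rewrite -normr_eq0 psi_norm oner_eq0.
have psi0 : psi 0 = 1 by apply: (mulfI (nz 0)); rewrite -psiD addr0 mulr1.
apply: (mulfI (nz x)); rewrite -psiD subrr psi0 -normCK psi_norm.
by rewrite expr1n.
Qed.

Let psi0 : psi 0 = 1.
Proof. by rewrite -(subrr 0) psiD -psi_conj -normCK psi_norm expr1n. Qed.

Let sum_psi a : \sum_x psi (x * a) = p%:R * (a == 0)%:R.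
Proof.
have [->|nz] := eqVneq a 0; last by rewrite psi_sum // mulr0.
rewrite (eq_bigr (fun=> 1)) => [|x _]; last by rewrite mulr0 psi0.
by rewrite sumr_const cardT -cardE cardF mulr1.
Qed.

Let orth1 y z : \sum_x psi (x * y) * (psi (x * z))^* = p%:R * (y == z)%:R.
Proof.
rewrite -subr_eq0 -sum_psi; apply: eq_bigr => x _.
by rewrite psi_conj -psiD mulrBr.
Qed.

Let psi2 (d e : F * F) : C := (psi (d.1 * e.1))^* * psi (d.2 * e.2).

Let orth2 y z : \sum_x psi2 x y * (psi2 x z)^* = (p ^ 2)%:R * (y == z)%:R.
Proof.
rewrite -(pair_bigA _ (fun u v => psi2 (u, v) y * (psi2 (u, v) z)^*)) /=.
case: y z => [y1 y2] [z1 z2]; rewrite xpair_eqE /psi2 /=.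
transitivity ((\sum_x psi (x * z1) * (psi (x * y1))^*) *
              (\sum_x psi (x * y2) * (psi (x * z2))^*)).
  rewrite mulr_suml; apply: eq_bigr => u _; rewrite mulr_sumr.
  by apply: eq_bigr => w _; rewrite rmorphM /= conjCK mulrACA [_^* * _]mulrC.
by rewrite !orth1 -mulnb natrM natrX eq_sym; ring.
Qed.

Definition bilin (I J : {set F}) : C := \sum_(x in I) \sum_(y in J) psi (x * y).

Lemma bilin_le_card (I J : {set F}) :
  `|bilin I J| ^+ 2 <= p%:R * (#|I| * #|J|)%:R.
Proof.
have := bilinear_le orth1 I J id id.
by rewrite /= !sum_sqr_card_eq natrM mulrA.
Qed.

Let v (J : {set F}) (x : F) : C := \sum_(y in J) psi (x * y).

Section BilinearBounds.
Variables I J : {set F}.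

(* With [B] the matrix [psi (x y)], [M] is the matrix [B B^* B], whose squared
   Frobenius norm is the trace of [(B B^* )^3]. *)
Let M (x y : F) : C :=
  \sum_(x' in I) \sum_(y' in J) psi (x * y') * (psi (x' * y'))^* * psi (x' * y).

Let trace : C := \sum_(x in I) \sum_(y in J) `|M x y| ^+ 2.

Let trace_ge0 : 0 <= trace.
Proof. by apply: sumr_ge0 => x _; apply: sumr_ge0 => y _; rewrite exprn_ge0. Qed.

(** The phase [x y' - x' y' + x' y - x y'' + x'' y'' - x'' y] equals
    [- (x - x')(y - y') + (x'' - x)(y'' - y)], so it depends on the triples only through
    [shifts3]. *)
Let traceE : trace = \sum_(z in setX (setX I I) I) \sum_(w in setX (setX J J) J)
  psi2 (shifts3 z) (shifts3 w).
Proof.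
transitivity (\sum_(x in I) \sum_(x' in I) \sum_(x'' in I)
    \sum_(y in J) \sum_(y' in J) \sum_(y'' in J)
    psi2 (shifts3 (x, x', x'')) (shifts3 (y, y', y''))).
  apply: eq_bigr => x _; pose a y x' y' := psi (x * y') * (psi (x' * y'))^* * psi (x' * y).
  transitivity (\sum_(y in J) \sum_(x' in I) \sum_(x'' in I)
      \sum_(y' in J) \sum_(y'' in J) a y x' y' * (a y x'' y'')^*).
    apply: eq_bigr => y _; rewrite normCK rmorph_sum big_distrlr.
    apply: eq_bigr => x' _; apply: eq_bigr => x'' _.
    by rewrite rmorph_sum big_distrlr.
  rewrite exchange_big; apply: eq_bigr => x' _ /=.
  rewrite exchange_big; apply: eq_bigr => x'' _ /=.
  apply: eq_bigr => y _; apply: eq_bigr => y' _; apply: eq_bigr => y'' _.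
  rewrite /a /psi2 /shifts3 /= !rmorphM /= !psi_conj !opprK -!psiD.
  by congr psi; ring.
rewrite (sum_pair_setX I I (fun x x' => \sum_(x'' in I) \sum_(y in J) \sum_(y' in J)
  \sum_(y'' in J) psi2 (shifts3 (x, x', x'')) (shifts3 (y, y', y'')))).
rewrite (sum_pair_setX (setX I I) I (fun z x'' => \sum_(y in J) \sum_(y' in J)
  \sum_(y'' in J) psi2 (shifts3 (z.1, z.2, x'')) (shifts3 (y, y', y'')))).
apply: eq_bigr => -[[x x'] x''] _ /=.
rewrite (sum_pair_setX J J (fun y y' => 
  \sum_(y'' in J) psi2 (shifts3 (x, x', x'')) (shifts3 (y, y', y'')))).
rewrite (sum_pair_setX (setX J J) J (fun w y'' =>
  psi2 (shifts3 (x, x', x'')) (shifts3 (w.1, w.2, y'')))).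
by apply: eq_bigr => -[[y y'] y''] _.
Qed.

(** The kernel [psi2] has [q = p^2], so [bilinear_le] and [shifts3_energy] give
    [trace^2 <= p^2 E_3(I) E_3(J)]. *)
Let trace_le (E : nat) : (energy3 I <= E)%N -> (energy3 J <= E)%N ->
  trace <= (p * E)%:R.
Proof.
move=> leI leJ; rewrite -(ler_pXn2r (isT : (0 < 2)%N)) ?nnegrE ?ler0n //.
have -> : trace ^+ 2 = `|trace| ^+ 2 by rewrite ger0_norm.
rewrite traceE; apply: le_trans (bilinear_le orth2 _ _ _ _) _.
rewrite -!natrM -natrX ler_nat expnMn -mulnA leq_mul2l -mulnn; apply/orP; right.
by apply: leq_mul; apply: leq_trans (shifts3_energy _) _.
Qed.

(** With [1] the all-ones vector on [J], these are the squared norms of [v = B 1], [u = B^* v] and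
    [w = B u]; they lead from [bilin] up to [trace]. *)
Let a1 : C := \sum_(x in I) `|v J x| ^+ 2.
Let u (y : F) : C := \sum_(x in I) (psi (x * y))^* * v J x.
Let a2 : C := \sum_(y in J) `|u y| ^+ 2.
Let w (x : F) : C := \sum_(y in J) psi (x * y) * u y.
Let a3 : C := \sum_(x in I) `|w x| ^+ 2.

Let sqr_norm_sum_le (T : finType) (A : {set T}) (f g : T -> C) :
  `|\sum_(x in A) f x * g x| ^+ 2 <=
    (\sum_(x in A) `|f x| ^+ 2) * (\sum_(x in A) `|g x| ^+ 2).
Proof.
apply: le_trans (cauchy_schwarz_ge0 (a := fun x => `|f x|) (b := fun x => `|g x|) _ _) => //.
rewrite lerXn2r ?nnegrE // ?sumr_ge0 // => [x _|]; first by rewrite mulr_ge0.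
by apply: le_trans (ler_norm_sum _ _ _) _; apply: ler_sum => x _; rewrite normrM.
Qed.

Let sqr_norm_sum1_le (T : finType) (A : {set T}) (f : T -> C) :
  `|\sum_(x in A) f x| ^+ 2 <= #|A|%:R * (\sum_(x in A) `|f x| ^+ 2).
Proof.
have := sqr_norm_sum_le A (fun=> 1) f; rewrite normr1 expr1n sumr_const.
by under eq_bigr => x _ do rewrite mul1r.
Qed.

Let a1_ge0 : 0 <= a1. Proof. by apply: sumr_ge0 => x _; rewrite exprn_ge0. Qed.
Let a2_ge0 : 0 <= a2. Proof. by apply: sumr_ge0 => x _; rewrite exprn_ge0. Qed.
Let a3_ge0 : 0 <= a3. Proof. by apply: sumr_ge0 => x _; rewrite exprn_ge0. Qed.

Let bilin_a1 : `|bilin I J| ^+ 2 <= #|I|%:R * a1.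
Proof. exact: sqr_norm_sum1_le. Qed.

(** By adjunction [a1 = <v, B 1> = <u, 1>]. *)
Let a1_a2 : a1 ^+ 2 <= #|J|%:R * a2.
Proof.
have -> : a1 ^+ 2 = `|\sum_(y in J) u y| ^+ 2.
  rewrite -(ger0_norm a1_ge0) -[in LHS](norm_conjC a1); congr (`|_| ^+ 2).
  rewrite rmorph_sum /u exchange_big; apply: eq_bigr => x _ /=.
  by rewrite -mulr_suml normCK rmorphM /= conjCK rmorph_sum.
exact: sqr_norm_sum1_le.
Qed.

(** By adjunction [a2 = <u, B^* v> = <w, v>]. *)
Let a2_a3 : a2 ^+ 2 <= a1 * a3.
Proof.
have -> : a2 ^+ 2 = `|\sum_(x in I) (v J x)^* * w x| ^+ 2.
  rewrite -(ger0_norm a2_ge0); congr (`|_| ^+ 2).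
  under [RHS]eq_bigr => x _ do rewrite /w mulr_sumr.
  rewrite exchange_big; apply: eq_bigr => y _ /=.
  rewrite normCK mulrC rmorph_sum mulr_suml; apply: eq_bigr => x _.
  by rewrite rmorphM /= conjCK mulrA [(v J x)^* * _]mulrC.
apply: le_trans (sqr_norm_sum_le _ _ _) _.
by under eq_bigr => x _ do rewrite norm_conjC.
Qed.

(** [w = M 1], so Cauchy-Schwarz applies in each row. *)
Let a3_trace : a3 <= #|J|%:R * trace.
Proof.
rewrite mulr_sumr; apply: ler_sum => x _; apply: le_trans (sqr_norm_sum1_le _ _).
rewrite le_eqVlt; apply/orP; left; apply/eqP; congr (`|_| ^+ 2).
pose a x' y y' := psi (x * y') * (psi (x' * y'))^* * psi (x' * y).
transitivity (\sum_(y' in J) \sum_(x' in I) \sum_(y in J) a x' y y').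
  apply: eq_bigr => y' _; rewrite mulr_sumr; apply: eq_bigr => x' _.
  by rewrite mulrA mulr_sumr.
transitivity (\sum_(x' in I) \sum_(y in J) \sum_(y' in J) a x' y y').
  by rewrite exchange_big; apply: eq_bigr => x' _; exact: exchange_big.
exact: exchange_big.
Qed.

(** The inequalities for [a1] and [a2] combine to [a1^3 <= #|J|^2 a3]; hence [|bilin|^6 <= #|I|^3
    a1^3 <= (#|I| #|J|)^3 trace]. *)
Lemma bilin_le_energy3 (E : nat) : (energy3 I <= E)%N -> (energy3 J <= E)%N ->
  `|bilin I J| ^+ 6 <= ((#|I| * #|J|) ^ 3)%:R * (p * E)%:R.
Proof.
move=> leI leJ; have tr := trace_le leI leJ.
have a1_cube : a1 ^+ 3 <= #|J|%:R ^+ 2 * a3.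
  have [->|nz] := eqVneq a1 0; first by rewrite expr0n mulr_ge0 // exprn_ge0.
  have a1_gt0 : 0 < a1 by rewrite lt_def nz.
  rewrite -(ler_pM2l a1_gt0) -exprS mulrCA -[4%N]/(2 * 2)%N exprM.
  apply: (le_trans (_ : _ <= (#|J|%:R * a2) ^+ 2)).
    by rewrite lerXn2r ?nnegrE ?mulr_ge0 ?exprn_ge0.
  by rewrite exprMn ler_wpM2l // exprn_ge0.
rewrite -[6%N]/(2 * 3)%N exprM.
apply: (le_trans (_ : _ <= (#|I|%:R * a1) ^+ 3)).
  by rewrite lerXn2r ?nnegrE ?mulr_ge0 ?exprn_ge0.
rewrite exprMn expnMn natrM !natrX -mulrA ler_wpM2l ?exprn_ge0 //.
apply: le_trans a1_cube _; rewrite [_ ^+ 3]exprSr -mulrA ler_wpM2l ?exprn_ge0 //.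
by apply: le_trans a3_trace _; rewrite ler_wpM2l.
Qed.

Let reps (K : {set F}) (s : F) : nat := #|[set z in setX (setX K K) K | sum3 z == s]|.

Let sum_reps K : \sum_s (reps K s)%:R = (#|K| ^ 3)%:R :> C.
Proof.
rewrite -natr_sum -(_ : #|setX (setX K K) K| = #|K| ^ 3)%N; last by rewrite !cardsX; lia.
congr _%:R; rewrite -[RHS]sum1_card (partition_big (@sum3 F) predT) //=.
apply: eq_bigr => s _; rewrite /reps -sum1_card; apply: eq_bigl => z.
by rewrite inE.
Qed.

Let v_cube x : v J x ^+ 3 = \sum_s (reps J s)%:R * psi (x * s).
Proof.
rewrite sum_cube (partition_big (@sum3 F) predT) //=; apply: eq_bigr => s _.
rewrite (eq_bigr (fun=> psi (x * s))); last first.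
  by move=> z /andP[_ /eqP <-]; rewrite -!psiD -!mulrDr.
by rewrite sumr_const mulr_natl /reps cardsE.
Qed.

(** The phase turning [v^3] into [|v|^3]; it is [0] where [v] vanishes, as [0 / 0 = 0]. *)
Let theta (x : F) : C := (`|v J x| / v J x) ^+ 3.

Let theta_le1 x : `|theta x| <= 1.
Proof.
rewrite normrX exprn_ile1 // normf_div normr_id.
have [->|nz] := eqVneq (v J x) 0; first by rewrite normr0 mul0r ler01.
by rewrite divff // normr_eq0.
Qed.

Let theta_v x : `|v J x| ^+ 3 = theta x * v J x ^+ 3.
Proof.
rewrite /theta -exprMn; have [->|nz] := eqVneq (v J x) 0.
  by rewrite normr0 mulr0.
by rewrite divfK.
Qed.

Let twisted (s : F) : C := \sum_(x in I) theta x * psi (s * x).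

Let cubes : C := \sum_(x in I) `|v J x| ^+ 3.

Let cubes_ge0 : 0 <= cubes.
Proof. by apply: sumr_ge0 => x _; rewrite exprn_ge0. Qed.

Let cubes_le : cubes <= \sum_s (reps J s)%:R * `|twisted s|.
Proof.
rewrite -[leLHS](ger0_norm cubes_ge0).
have -> : cubes = \sum_s (reps J s)%:R * twisted s.
  under [RHS]eq_bigr => s _ do rewrite mulr_sumr.
  rewrite exchange_big; apply: eq_bigr => x _ /=; rewrite theta_v v_cube mulr_sumr.
  by apply: eq_bigr => s _; rewrite mulrCA [s * x]mulrC.
by apply: le_trans (ler_norm_sum _ _ _) _; apply: ler_sum => s _; rewrite normrM normr_nat.
Qed.

(** The cube of [twisted] is a character sum whose coefficient at [s] is at most [reps I s] in norm,
    since [|theta| <= 1]; then Parseval. *)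
Let sum_twisted : \sum_s `|twisted s| ^+ 6 <= p%:R * (additive_energy6 I)%:R.
Proof.
pose c (z : F * F * F) := theta z.1.1 * theta z.1.2 * theta z.2.
pose f s := \sum_(z in setX (setX I I) I | sum3 z == s) c z.
have tE s : twisted s ^+ 3 = \sum_x f x * psi (s * x).
  rewrite sum_cube (partition_big (@sum3 F) predT) //=; apply: eq_bigr => x _.
  rewrite mulr_suml; apply: eq_bigr => z /andP[_ /eqP <-].
  by rewrite /c !mulrDr !psiD; ring.
under eq_bigr => s _ do rewrite -[6%N]/(3 * 2)%N exprM -normrX tE.
rewrite (parseval_kernel orth1) ler_wpM2l // natr_sum; apply: ler_sum => s _.
rewrite natrX lerXn2r ?nnegrE //; apply: le_trans (ler_norm_sum _ _ _) _.
apply: (le_trans (_ : _ <= \sum_(z in setX (setX I I) I | sum3 z == s) 1)).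
  apply: ler_sum => z _; rewrite /c (normrM (_ * _)) (normrM (theta _)).
  by rewrite !mulr_ile1 ?mulr_ge0 ?theta_le1.
by rewrite sumr_const cardsE.
Qed.

(** Hoelder over [I], then over [s], then Cauchy-Schwarz give [|bilin|^18 <= (#|I| #|J|)^12 p T_3(I)
    T_3(J)]; three of the twelve factors [#|I| #|J|] are replaced by [t^2]. *)
Lemma bilin_le_energy6 (t E : nat) : (#|I| <= t)%N -> (#|J| <= t)%N ->
  (additive_energy6 I <= E)%N -> (additive_energy6 J <= E)%N ->
  `|bilin I J| ^+ 18 <= ((#|I| * #|J|) ^ 9)%:R * (t ^ 6 * p * E ^ 2)%:R.
Proof.
move=> It Jt EI EJ.
have bilin_cube : `|bilin I J| ^+ 3 <= #|I|%:R ^+ 2 * cubes.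
  have := cube_weighted_mean (A := mem I) (w := fun=> 1) (a := fun x => `|v J x|).
  rewrite sumr_const; under eq_bigr => x _ do rewrite mul1r.
  under [X in _ * X]eq_bigr => x _ do rewrite mul1r.
  move=> /(_ (fun _ _ => ler01) (fun _ _ => normr_ge0 _)); apply: le_trans.
  by rewrite lerXn2r ?nnegrE //; [exact: sumr_ge0|exact: ler_norm_sum].
have cubes6 : cubes ^+ 6 <= (#|J| ^ 12 * E)%:R * (p * E)%:R.
  have c3 : cubes ^+ 3 <= (#|J| ^ 3)%:R ^+ 2 * \sum_s (reps J s)%:R * `|twisted s| ^+ 3.
    rewrite -sum_reps; apply: le_trans (cube_weighted_mean _ _) => //.
    by rewrite lerXn2r ?nnegrE //; apply: sumr_ge0 => s _; rewrite mulr_ge0.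
  rewrite -[6%N]/(3 * 2)%N exprM.
  apply: (le_trans (_ : _ <= ((#|J| ^ 3)%:R ^+ 2 * \sum_s (reps J s)%:R * `|twisted s| ^+ 3) ^+ 2)).
    by rewrite lerXn2r ?nnegrE ?exprn_ge0 //; apply: le_trans c3; rewrite exprn_ge0.
  rewrite exprMn natrM -mulrA -!natrX -!expnM ler_wpM2l //.
  apply: le_trans (cauchy_schwarz_ge0 _ _) _ => //.
    by move=> s _; rewrite exprn_ge0.
  apply: ler_pM.
  - by apply: sumr_ge0 => s _; rewrite exprn_ge0.
  - by apply: sumr_ge0 => s _; rewrite !exprn_ge0.
  - by under eq_bigr => s _ do rewrite -natrX; rewrite -natr_sum ler_nat.
  under eq_bigr => s _ do rewrite -exprM.
  by apply: le_trans sum_twisted _; rewrite -natrM ler_nat leq_mul2l EI orbT.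
rewrite -[18%N]/(3 * 6)%N exprM.
apply: (le_trans (_ : _ <= (#|I|%:R ^+ 2 * cubes) ^+ 6)).
  by rewrite lerXn2r ?nnegrE ?mulr_ge0 ?exprn_ge0.
rewrite exprMn; apply: (le_trans (ler_wpM2l _ cubes6)); first by rewrite !exprn_ge0.
rewrite -!natrX -!natrM ler_nat -expnM.
have le6 : ((#|I| * #|J|) ^ 3 <= t ^ 6)%N.
  by rewrite -[6%N]/(2 * 3)%N expnM leq_exp2r // -mulnn leq_mul.
apply: (@leq_trans ((#|I| * #|J|) ^ 9 * ((#|I| * #|J|) ^ 3 * (p * E ^ 2)))).
  rewrite [leqRHS]mulnA -expnD expnMn -(mulnn E) /=.
  by move: (#|I| ^ _)%N (#|J| ^ _)%N => x y; clear; lia.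
by rewrite leq_mul2l -mulnA leq_mul2r le6 !orbT.
Qed.

End BilinearBounds.
End CharacterSums.

(** * From bilinear sums to incomplete sums *)

Section Completion.
Variables (C : numFieldType) (b : nat -> C) (t : nat) (mu : C).
Hypothesis mu_ge0 : 0 <= mu.
Hypothesis bilinear : forall i K M, (K <= t)%N -> (M <= t)%N ->
  `|\sum_(x < K) \sum_(y < M) b (i + x + y)%N| ^+ 2 <= mu ^+ 2 * (K * M)%:R.

Let partial (n : nat) : C := \sum_(x < n) b x.

Let partial_add n k : partial (n + k) = partial n + \sum_(y < k) b (n + y)%N.
Proof.
by rewrite /partial big_split_ord.
Qed.

(* Averaging [partial] over windows of doubling length changes it by bilinear
   sums only, so that no Fourier completion is needed. *)
Let window K n : C := \sum_(k < K) partial (n + k).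

(** The second half of the doubled window is the first one moved by [K]; each partial sum then
    changes by [K] consecutive terms, which gives a [K] by [K] bilinear sum. *)
Let window_double K n : (K <= t)%N ->
  `|2%:R * window K n - window (K + K) n| <= mu * K%:R.
Proof.
move=> leK; have -> : 2%:R * window K n - window (K + K) n =
    - \sum_(k < K) \sum_(y < K) b (n + k + y)%N.
  rewrite {2}/window big_split_ord /= mulr_natl mulr2n opprD addrA addrK.
  rewrite -sumrB -sumrN; apply: eq_bigr => k _.
  rewrite (_ : n + (K + k) = n + k + K)%N; last by lia.
  by rewrite (partial_add (n + k)) opprD addrA subrr sub0r.
rewrite normrN -(ler_pXn2r (isT : (0 < 2)%N)) ?nnegrE ?mulr_ge0 //.
by rewrite exprMn -natrX -mulnn bilinear.
Qed.

(** Relative to the window length, each of the [m] doublings costs [mu]. At length [2^m] the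
    remaining difference is itself a [2^m] by [N] bilinear sum and costs [2 mu]. *)
Lemma completion (m N : nat) : (2 ^ m <= t)%N -> (t < 2 ^ m.+1)%N -> (N <= t)%N ->
  `|\sum_(x < N) b x| <= (m.+2)%:R * mu.
Proof.
move=> le_mt lt_tm leN; pose delta j := window (2 ^ j) N - window (2 ^ j) 0.
have delta0 : delta 0%N = \sum_(x < N) b x.
  by rewrite /delta /window !big_ord1 addn0 {2}/partial big_ord0 subr0.
have step j : (j <= m)%N ->
    (2 ^ j)%:R * `|delta 0%N| <= `|delta j| + j%:R * (mu * (2 ^ j)%:R).
  elim: j => [|j IH] ltj; first by rewrite mul1r mul0r addr0.
  have ltjt : (2 ^ j <= t)%N by apply: leq_trans le_mt; rewrite leq_pexp2l // ltnW.
  have d2 : `|2%:R * delta j - delta j.+1| <= 2%:R * (mu * (2 ^ j)%:R).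
    rewrite /delta expnS mul2n -addnn.
    set u := window _ N; set v := window _ 0; set u' := window _ N; set v' := window _ 0.
    rewrite (_ : _ - _ = (2%:R * u - u') - (2%:R * v - v')); last by ring.
    apply: le_trans (ler_normB _ _) _; rewrite [leRHS]mulr_natl mulr2n.
    by apply: lerD; apply: window_double.
  have tri : 2%:R * `|delta j| <= `|delta j.+1| + 2%:R * (mu * (2 ^ j)%:R).
    rewrite -[X in X * _]normr_nat -normrM -[X in `|X|](subrK (delta j.+1)).
    by apply: le_trans (ler_normD _ _) _; rewrite [leLHS]addrC lerD2l.
  rewrite expnS natrM -mulrA; apply: le_trans (ler_wpM2l _ (IH (ltnW ltj))) _ => //.
  rewrite mulrDr; apply: le_trans (lerD tri (lexx _)) _.
  rewrite -addrA lerD2l -[j.+1]addn1 natrD le_eqVlt; apply/orP; left; apply/eqP; ring.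
have deltam : `|delta m| <= 2%:R * (mu * (2 ^ m)%:R).
  have -> : delta m = \sum_(x < 2 ^ m) \sum_(y < N) b (0 + x + y)%N.
    rewrite /delta /window -sumrB; apply: eq_bigr => k _.
    by rewrite add0n addnC partial_add addrAC subrr add0r.
  rewrite -(ler_pXn2r (isT : (0 < 2)%N)) ?nnegrE ?mulr_ge0 //.
  apply: le_trans (bilinear _ _ _) _ => //.
  (* [N < 2 * 2^m] is weakened to [4 * 2^m] to obtain a perfect square. *)
  rewrite [leRHS](_ : _ = mu ^+ 2 * (2 ^ m * (4 * 2 ^ m))%:R).
    rewrite ler_wpM2l ?exprn_ge0 // ler_nat leq_mul2l; apply/orP; right.
    by apply: leq_trans leN _; apply: leq_trans (ltnW lt_tm) _; rewrite expnS; lia.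
  by rewrite !natrM; ring.
have pos : 0 < (2 ^ m)%:R :> C by rewrite ltr0n expn_gt0.
rewrite -delta0 -(ler_pM2l pos).
apply: le_trans (step m (leqnn m)) _; apply: le_trans (lerD deltam (lexx _)) _.
rewrite -[m.+2]addn2 natrD le_eqVlt; apply/orP; left; apply/eqP; ring.
Qed.
End Completion.

(** * Sums over consecutive powers *)

Section PowerSums.
Variables (C : numClosedFieldType) (F : finFieldType) (psi : F -> C) (g : F) (t : nat).
Hypothesis g_neq0 : g != 0.
Hypothesis g_inj : forall i j, (i < t)%N -> (j < t)%N -> g ^+ i = g ^+ j -> i = j.
Hypothesis gt1 : g ^+ t = 1.
Let G := roots_of_unity F t.

Let powers (i K : nat) : {set F} := [set g ^+ (i + x) | x : 'I_K].

Let powers_inj i K : (K <= t)%N -> injective (fun x : 'I_K => g ^+ (i + x)).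
Proof.
move=> leK x y; rewrite !exprD => /(mulfI (expf_neq0 _ g_neq0)) e; apply: val_inj.
by apply: g_inj e; apply: leq_trans leK.
Qed.

Let powers_sub i K : powers i K \subset G.
Proof.
by apply/subsetP => _ /imsetP[x _ ->]; rewrite inE exprAC gt1 expr1n.
Qed.

(** At most [t] consecutive powers of [g] are distinct, so double sums over exponents are bilinear
    sums over subsets of [G]. The form with [2 k] and [X] covers the three bounds, [k = 1, 3, 9],
    without extracting roots. *)
Lemma power_sum_le (X k m N : nat) (mu : C) : (0 < k)%N -> 0 <= mu ->
  (forall I J : {set F}, I \subset G -> J \subset G -> (#|I| <= t)%N -> (#|J| <= t)%N ->
    `|bilin psi I J| ^+ (2 * k) <= ((#|I| * #|J|) ^ k)%:R * X%:R) ->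
  X%:R <= mu ^+ (2 * k) ->
  (2 ^ m <= t)%N -> (t < 2 ^ m.+1)%N -> (N <= t)%N ->
  `|\sum_(1 <= n < N.+1) psi (g ^+ n)| <= (m.+2)%:R * mu.
Proof.
move=> k0 mu0 bil Xmu le1 le2 leN; rewrite big_add1 /= big_mkord.
apply: (completion (b := fun n => psi (g ^+ n.+1)) (t := t)) => // i K M leK leM.
have -> : \sum_(x < K) \sum_(y < M) psi (g ^+ (i + x + y).+1) =
    bilin psi (powers i K) (powers 1 M).
  rewrite /bilin big_imset /=; last by move=> x y _ _; exact: powers_inj.
  apply: eq_bigr => x _; rewrite big_imset /=; last by move=> z y _ _; exact: powers_inj.
  by apply: eq_bigr => y _; rewrite -exprD add1n addnS.
have cI : #|powers i K| = K by rewrite card_imset ?card_ord //; exact: powers_inj.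
have cJ : #|powers 1 M| = M by rewrite card_imset ?card_ord //; exact: powers_inj.
have := bil (powers i K) (powers 1 M) (powers_sub _ _) (powers_sub _ _).
rewrite cI cJ => /(_ leK leM) le3.
rewrite -(ler_pXn2r k0) ?nnegrE ?mulr_ge0 ?exprn_ge0 // -exprM.
apply: le_trans le3 _; rewrite exprMn -exprM mulrC natrX.
by rewrite ler_wpM2r // exprn_ge0.
Qed.
End PowerSums.

(* Imported only here because [classical_sets] shadows many names of [finset]. *)
From mathcomp Require Import all_classical all_reals all_analysis complex cyclic.
Import Order.TTheory GRing.Theory Num.Theory.

(** * The additive character of the prime field *)

Section AdditiveCharacter.
Variable R : realType.

Lemma cisD (x y : R) : cis (x + y) = cis x * cis y.
Proof. by rewrite /cis cosD sinD; simpc; congr (_ +i* _)%C; ring. Qed.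

Lemma normc_cis (x : R) : `|cis x| = 1.
Proof. by rewrite /cis normc_def /= cos2Dsin2 sqrtr1. Qed.

Lemma cis_2pi_nat (n : nat) : cis (2 * pi * n%:R : R) = 1.
Proof.
have cis2pi : cis (2 * pi : R) = 1 by rewrite /cis mulr_natl cos2pi sin2pi.
elim: n => [|n IH]; first by rewrite mulr0 /cis cos0 sin0.
have -> : 2 * pi * n.+1%:R = 2 * pi * n%:R + 2 * pi :> R by rewrite -natr1; ring.
by rewrite cisD IH mul1r.
Qed.

Variable p : nat.
Hypothesis p_pr : prime p.

Lemma additive_charD (x y : 'F_p) :
  additive_char R (x + y) = additive_char R x * additive_char R y.
Proof.
have p0 : p%:R != 0 :> R by rewrite pnatr_eq0 -lt0n prime_gt0.
rewrite /additive_char -cisD.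
(* Adding residues produces a carry, a multiple of [p], which [cis_2pi_nat] removes. *)
have e : (x + y = ((x + y) %/ p) * p + (x + y)%R :> nat)%N.
  rewrite [LHS](divn_eq (x + y) p); congr (_ + _)%N.
  transitivity ((x + y) %% (Zp_trunc (pdiv p)).+2)%N => //.
  by congr modn; exact: esym (Fp_cast p_pr).
have -> : 2 * pi * (x : nat)%:R / p%:R + 2 * pi * (y : nat)%:R / p%:R =
  2 * pi * ((x + y) %/ p)%N%:R + 2 * pi * (x + y : 'F_p)%R%:R / p%:R :> R.
  have := congr1 (fun n => n%:R : R) e; rewrite !natrD natrM => e'.
  rewrite -mulrDl -mulrDr e'; by field.
by rewrite cisD cis_2pi_nat mul1r.
Qed.

(** [2 pi / p] lies in [(0, pi]], where the cosine is below [1]. *)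
Lemma additive_char1_neq1 : additive_char R (1 : 'F_p) != 1.
Proof.
have p1 : 1 < p%:R :> R by rewrite ltr1n prime_gt1.
have p0 : 0 < p%:R :> R by apply: lt_trans p1.
have p2 : 2 <= p%:R :> R by rewrite ler_nat prime_gt1.
rewrite /additive_char; have -> : ((1 : 'F_p)%R : nat) = 1%N by [].
apply/negP => /eqP[cos1 _].
have pi0 := pi_gt0 R.
have : cos (2 * pi * 1%:R / p%:R : R) < cos 0.
  rewrite ltr_cos ?in_itv /= ?lexx ?pi_ge0 //.
    by rewrite divr_gt0 // !mulr_gt0.
  apply/andP; split; first by rewrite divr_ge0 ?mulr_ge0 ?ltW.
  by rewrite ler_pdivrMr // mulr1 [leRHS]mulrC ler_pM2r.
by rewrite cos1 cos0 ltxx.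
Qed.

(** Translating [x] by [a^-1] multiplies the sum by the value at [1], which is not [1]. *)
Lemma sum_additive_char (a : 'F_p) : a != 0 ->
  \sum_x additive_char R (x * a) = 0.
Proof.
move=> a0; set S := LHS.
have shift : additive_char R (1 : 'F_p) * S = S.
  rewrite [in RHS]/S (reindex_inj (addrI a^-1)) /= mulr_sumr.
  by apply: eq_bigr => x _; rewrite mulrDl mulVf // additive_charD.
have /eqP : (additive_char R (1 : 'F_p) - 1) * S = 0.
  by rewrite mulrBl mul1r shift subrr.
by rewrite mulf_eq0 subr_eq0 (negPf additive_char1_neq1) => /eqP.
Qed.
End AdditiveCharacter.

(** * The three bounds for the exponential sum *)

Section ExpSum.
Variables (R : realType) (p : nat) (g : {unit 'F_p}) (t N : nat) (lambda : int).
Hypotheses (p_pr : prime p) (order_g : #[g]%g = t) (le_Nt : (N <= t)%N).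
Hypothesis lambda_p : coprimez lambda p%:Z.
Let G := roots_of_unity 'F_p t.

Let t_gt0 : (0 < t)%N. Proof. by rewrite -order_g order_gt0. Qed.

Let charF : p \in [pchar 'F_p]. Proof. exact: pchar_Fp. Qed.

Let val_g_neq0 : val g != 0.
Proof. by rewrite -unitfE; exact: (valP g). Qed.

Let val_g_inj i j : (i < t)%N -> (j < t)%N ->
  val g ^+ i = val g ^+ j -> i = j.
Proof.
move=> lti ltj; rewrite -!FinRing.val_unitX => /val_inj /eqP.
by rewrite eq_expg_mod_order order_g !modn_small // => /eqP.
Qed.

Let val_g_expt : val g ^+ t = 1.
Proof. by rewrite -FinRing.val_unitX -order_g expg_order. Qed.

Let cardG : #|G| = t.
Proof.
apply/eqP; rewrite eqn_leq (card_unity_roots_le t_gt0) /=.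
have inj : injective (fun i : 'I_t => val g ^+ i).
  by move=> i j e; apply: val_inj; exact: val_g_inj e.
rewrite -[X in (X <= _)%N]card_ord -(card_imset _ inj).
apply/subset_leq_card/fintype.subsetP => _ /imsetP[i _ ->].
by rewrite inE exprAC val_g_expt expr1n.
Qed.

Let lambda_neq0 : lambda%:~R != 0 :> 'F_p.
Proof.
apply: contraL lambda_p => l0; have : `|lambda|%N%:R == 0 :> 'F_p.
  move: l0; rewrite {1}[lambda]intEsign rmorphM rmorph_sign.
  by rewrite mulf_eq0 signr_eq0.
rewrite -(dvdn_pcharf charF) /coprimez /gcdz /= eqz_nat => /gcdn_idPr ->.
by rewrite gtn_eqF // prime_gt1.
Qed.

Let psi (x : 'F_p) : R[i] := additive_char R (lambda%:~R * x).

Let psiD x y : psi (x + y) = psi x * psi y.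
Proof. by rewrite /psi mulrDr additive_charD. Qed.

Let psi_norm x : `|psi x| = 1.
Proof. exact: normc_cis. Qed.

Let psi_sum a : a != 0 -> \sum_x psi (x * a) = 0.
Proof.
move=> a0; rewrite -[RHS](sum_additive_char R p_pr (mulf_neq0 lambda_neq0 a0)).
by apply: eq_bigr => x _; rewrite /psi mulrCA.
Qed.

Let S : R := Normc.normc (exp_sum R g lambda N).

Let normC_exp_sum : `|\sum_(1 <= n < N.+1) psi (val g ^+ n)| = S%:C%C.
Proof. by rewrite normc_def /S /exp_sum; case: (\sum_(_ <= _ < _) _). Qed.

Variable m : nat.
Hypotheses (le_mt : (2 ^ m <= t)%N) (lt_tm : (t < 2 ^ m.+1)%N).

Let exp_sum_le (X k : nat) (mu : R) : (0 < k)%N -> 0 <= mu ->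
  (forall I J : {set 'F_p}, I \subset G -> J \subset G ->
    (#|I| <= t)%N -> (#|J| <= t)%N ->
    `|bilin psi I J| ^+ (2 * k) <= ((#|I| * #|J|) ^ k)%:R * X%:R) ->
  X%:R <= mu ^+ (2 * k) -> S <= m.+2%:R * mu.
Proof.
move=> k0 mu0 bil Xmu.
have toC n : n%:R = n%:R%:C%C :> R[i] by rewrite (rmorph_nat (real_complex R)).
have : `|\sum_(1 <= n < N.+1) psi (val g ^+ n)| <= m.+2%:R * mu%:C%C.
  apply: (power_sum_le val_g_neq0 val_g_inj val_g_expt k0 _ bil) => //.
    by rewrite (lecR 0).
  by rewrite toC -rmorphXn lecR.
by rewrite normC_exp_sum toC -rmorphM lecR.
Qed.

Lemma exp_sum_le_sqrt (mu : R) : 0 <= mu -> p%:R <= mu ^+ 2 -> S <= m.+2%:R * mu.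
Proof.
move=> mu0 le_mu; apply: (exp_sum_le (X := p) (k := 1)) => // I J _ _ _ _.
by rewrite muln1 expn1 mulrC; exact: (bilin_le_card (card_Fp p_pr)).
Qed.

Lemma exp_sum_le_energy3 (mu : R) : 0 <= mu -> (t ^ 3 <= p ^ 2)%N ->
  (p * ((8 * level_const + 1) * m.+1 * t ^ 3))%:R <= mu ^+ 6 ->
  S <= m.+2%:R * mu.
Proof.
move=> mu0 le_tp; set X := (p * _)%N; rewrite -[6%N]/(2 * 3)%N => le_mu.
refine (exp_sum_le (X := X) (k := 3) (isT : (0 < 3)%N) mu0 _ le_mu).
move=> {le_mu} I J IG JG _ _.
have E := energy3_roots_of_unity charF (card_Fp p_pr) t_gt0 cardG le_tp lt_tm.
apply: (bilin_le_energy3 (card_Fp p_pr)) => //; apply: leq_trans E; exact: energy3_mono.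
Qed.

Lemma exp_sum_le_energy6 (mu : R) : 0 <= mu -> (t ^ 2 <= p)%N ->
  (t ^ 6 * p * ((8 * level_const + 5) * m.+1 * t ^ 4) ^ 2)%:R <= mu ^+ 18 ->
  S <= m.+2%:R * mu.
Proof.
move=> mu0 le_tp; set X := (t ^ 6 * _ * _)%N; rewrite -[18%N]/(2 * 9)%N => le_mu.
refine (exp_sum_le (X := X) (k := 9) (isT : (0 < 9)%N) mu0 _ le_mu).
move=> {le_mu} I J IG JG It Jt.
have E := additive_energy6_roots_of_unity charF (card_Fp p_pr) t_gt0 cardG le_tp lt_tm.
apply: (bilin_le_energy6 (card_Fp p_pr)) => //; apply: leq_trans E; exact: additive_energy6_mono.
Qed.
End ExpSum.

(** * Comparison of exponents *)

Section Exponents.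
Variable R : realType.

Lemma powR_expR (x a : R) : 0 < x -> x `^ a = expR (a * ln x).
Proof. by move=> x0; rewrite /powR gt_eqF. Qed.

(** The [3] comes from [m ln 2 <= ln p] and twice [ln 2 <= ln p]. *)
Lemma natr_le_expR (m p : nat) : (1 < p)%N -> (2 ^ m <= p)%N ->
  m.+2%:R <= expR (ln (3 / ln 2) + ln (ln (p%:R : R))).
Proof.
move=> p1 le_mp; have ln2 : 0 < ln 2 :> R by rewrite ln_gt0 // ltr1n.
have p0 : 0 < p%:R :> R by rewrite ltr0n ltnW.
have lnp : 0 < ln (p%:R : R) by rewrite ln_gt0 // ltr1n.
rewrite expRD !lnK ?posrE ?divr_gt0 // -mulrA [_^-1 * _]mulrC mulrA ler_pdivlMr //.
have : m%:R * ln 2 <= ln p%:R :> R.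
  rewrite mulr_natl -lnXn // ler_ln ?posrE ?exprn_gt0 //.
  by rewrite -natrX ler_nat.
have : ln 2 <= ln p%:R :> R by rewrite ler_ln ?posrE // ler_nat.
move=> h2 hm; rewrite -addn2 natrD mulrDl; lra.
Qed.
End Exponents.

Theorem theorem3 (R : realType) :
  exists C : R, 0 < C /\
    forall (p : nat) (g : {unit 'F_p}) (t N : nat),
      prime p -> #[g]%g = t -> (0 < N)%N -> (N <= t)%N ->
      forall lambda : int, coprimez lambda p%:Z ->
        let P : R := p%:R in
        let T : R := t%:R in
        let L : R := ln P in
        let S : R := Normc.normc (exp_sum R g lambda N) in
        [/\ T <= P `^ (1 / 2) ->
              S <= C * (P `^ (1 / 8) * T `^ (22 / 36) * L `^ (7 / 6)),
            P `^ (1 / 2) < T -> T <= P `^ (3 / 5) * L `^ (- (6 / 5)) ->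
              S <= C * (P `^ (1 / 4) * T `^ (13 / 36) * L `^ (7 / 6)),
            P `^ (3 / 5) * L `^ (- (6 / 5)) < T ->
            T <= P `^ (2 / 3) * L `^ (- (2 / 3)) ->
              S <= C * (P `^ (1 / 6) * T `^ (1 / 2) * L `^ (4 / 3)) &
            P `^ (2 / 3) * L `^ (- (2 / 3)) < T ->
              S <= C * (P `^ (1 / 2) * L)].
Proof.
(* [a], [k3] and [k6] are logarithms of the constants in the three bounds. [b] bounds [ln (ln p)]
   from below; as this may be negative, comparing powers of [ln p] costs multiples of [|b|]. *)
pose a : R := ln (3 / ln 2).
pose b : R := ln (ln 2).
pose k3 : R := ln (8 * level_const + 1)%N%:R.
pose k6 : R := ln (8 * level_const + 5)%N%:R.
pose c : R := 2 * `|a| + `|k3| + `|k6| + 20 * `|b|.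
have [a1 a2] : a <= `|a| /\ - a <= `|a| by rewrite ler_norm -normrN ler_norm.
have [b1 b2] : b <= `|b| /\ - b <= `|b| by rewrite ler_norm -normrN ler_norm.
have [k31 k32] : k3 <= `|k3| /\ - k3 <= `|k3| by rewrite ler_norm -normrN ler_norm.
have [k61 k62] : k6 <= `|k6| /\ - k6 <= `|k6| by rewrite ler_norm -normrN ler_norm.
exists (expR c); split=> [|p g t N p_pr order_g N0 le_Nt lambda lambda_p P T L S].
  exact: expR_gt0.
have p1 := prime_gt1 p_pr.
have ln2 : 0 < ln 2 :> R by rewrite ln_gt0 // ltr1n.
have P0 : 0 < P by rewrite ltr0n prime_gt0.
have t0 : (0 < t)%N by rewrite -order_g order_gt0.
have T0 : 0 < T by rewrite ltr0n.
have le2L : ln 2 <= L by rewrite ler_ln ?posrE // ler_nat.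
have L0 : 0 < L by apply: lt_le_trans le2L.
(* Everything is written as an exponential, so that all comparisons become linear in [L], [lT] and
   [lL]. *)
pose lT := ln T; pose lL := ln L.
have PE : P = expR L by rewrite lnK.
have TE : T = expR lT by rewrite lnK.
have LE : L = expR lL by rewrite lnK.
have le_b : b <= lL by rewrite ler_ln ?posrE.
have le_tp : (t <= p)%N.
  have := leq_card (val : {unit 'F_p} -> 'F_p) val_inj; rewrite card_Fp //.
  by apply: leq_trans; rewrite -order_g max_card.
pose m := trunc_log 2 t.
have le_mt : (2 ^ m <= t)%N by exact: trunc_logP.
have lt_tm : (t < 2 ^ m.+1)%N by exact: trunc_log_ltn.
have m2 : m.+2%:R <= expR (a + lL).
  by apply: natr_le_expR => //; exact: leq_trans le_tp.
have m1 : m.+1%:R <= expR (a + lL) by apply: le_trans m2; rewrite ler_nat.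
have mul_m2 y : S <= m.+2%:R * expR y -> S <= expR (a + lL + y).
  by move=> le; apply: le_trans le _; rewrite expRD ler_wpM2r // expR_ge0.
have k3E : (8 * level_const + 1)%N%:R = expR k3 by rewrite lnK // posrE ltr0n addn1.
have k6E : (8 * level_const + 5)%N%:R = expR k6 by rewrite lnK // posrE ltr0n addnS.
have bound0 : S <= expR (a + lL + L / 2).
  apply: mul_m2; apply: (exp_sum_le_sqrt p_pr order_g le_Nt lambda_p le_mt lt_tm).
    exact: expR_ge0.
  by rewrite -expRM_natl -/P PE ler_expR; lra.
have bound3 : 3 * lT <= 2 * L -> S <= expR (a + lL + (L + k3 + (a + lL) + 3 * lT) / 6).
  move=> leTL; apply: mul_m2.
  apply: (exp_sum_le_energy3 p_pr order_g le_Nt lambda_p le_mt lt_tm).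
  - exact: expR_ge0.
  - by rewrite -(ler_nat R) !natrX -/P -/T PE TE -!expRM_natl ler_expR.
  rewrite -expRM_natl [6%:R * _]mulrC divfK // natrM (natrM _ _ (t ^ 3)) natrM natrX -/P -/T k3E.
  rewrite 3!expRD expRM_natl -PE -TE -!mulrA.
  by rewrite !ler_wpM2l ?expR_ge0 ?(ltW P0) // ler_wpM2r // exprn_ge0 // ltW.
have bound6 : 2 * lT <= L ->
    S <= expR (a + lL + (6 * lT + L + 2 * (k6 + (a + lL) + 4 * lT)) / 18).
  move=> leTL; apply: mul_m2.
  apply: (exp_sum_le_energy6 p_pr order_g le_Nt lambda_p le_mt lt_tm).
  - exact: expR_ge0.
  - by rewrite -(ler_nat R) natrX -/P -/T PE TE -!expRM_natl ler_expR.
  rewrite -expRM_natl [18%:R * _]mulrC divfK // (natrM _ _ (_ ^ 2)) (natrM _ (t ^ 6)) !natrX.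
  rewrite (natrM _ _ (t ^ 4)) natrM natrX -/P -/T k6E.
  rewrite 2!expRD !expRM_natl -PE -TE ler_wpM2l ?mulr_ge0 ?exprn_ge0 ?(ltW P0) ?(ltW T0) //.
  rewrite lerXn2r ?nnegrE ?mulr_ge0 ?expR_ge0 ?exprn_ge0 ?(ltW T0) //.
  rewrite 2!expRD expRM_natl -TE -!mulrA.
  by rewrite !ler_wpM2l ?expR_ge0 // ler_wpM2r // exprn_ge0 // ltW.
have PX x : P `^ x = expR (x * L) by rewrite powR_expR.
have TX x : T `^ x = expR (x * lT) by rewrite powR_expR.
have LX x : L `^ x = expR (x * lL) by rewrite powR_expR.
have expR_le x y : S <= expR x -> x <= y -> S <= expR y.
  by move=> le le'; apply: le_trans le _; rewrite ler_expR.
rewrite !PX !TX !LX {1 2 3 4 5 6}TE -!expRD !ler_expR !ltr_expR.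
split.
(* Up to powers of [L], [bound3] meets the target exactly at [t = p^(3/8)] and stays below it for
   larger [t]. *)
- move=> h1; have [h|h] := leP (8 * lT) (3 * L).
    apply: (expR_le _ _ (bound6 _)); [lra|rewrite /c; lra].
  apply: (expR_le _ _ (bound3 _)); [lra|rewrite /c; lra].
(* [h2] gives [3 lT <= 2 L] when [lL >= 0]; [bound0] covers the remaining case. *)
- move=> h1 h2; have [h|h] := leP (3 * lT) (2 * L).
    by apply: (expR_le _ _ (bound3 h)); rewrite /c; lra.
  by apply: (expR_le _ _ bound0); rewrite /c; lra.
- move=> h1 h2; have [h|h] := leP (3 * lT) (2 * L).
    by apply: (expR_le _ _ (bound3 h)); rewrite /c; lra.
  by apply: (expR_le _ _ bound0); rewrite /c; lra.
- move=> h1; rewrite [X in _ * (_ * X)]LE -!expRD.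
  by apply: (expR_le _ _ bound0); rewrite /c; lra.
Qed.
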